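(* Let $(X,\sigma)$ be a transitive sofic shift with $X$ infinite. Then every normal amenable subgroup of $\mathrm{Aut}(X)$ is contained in $\langle \sigma\rangle$, the subgroup of $\mathrm{Aut}(X)$ generated by the shift map.
   Context: Let $\mathcal{A}$ be a finite alphabet with the discrete topology, and give $\mathcal{A}^{\mathbb{Z}}$ the product topology. The shift map $\sigma:\mathcal{A}^{\mathbb{Z}}\to\mathcal{A}^{\mathbb{Z}}$ is $(\sigma x)_n=x_{n+1}$. A shift $(X,\sigma)$ is a closed set $X\subset\mathcal{A}^{\mathbb{Z}}$ that is shift-invariant ($\sigma X=X$). The language $\mathcal{L}(X)$ is the set of all finite words occurring in points of $X$. A shift is transitive if for all $u,w\in\mathcal{L}(X)$ there is a word $v$ with $uvw\in\mathcal{L}(X)$. A shift is of finite type (an SFT) if there is a finite set $\mathcal{F}$ of words such that $X$ consists exactly of the points of $\mathcal{A}^{\mathbb{Z}}$ in which no word of $\mathcal{F}$ occurs. A shift is sofic if it is a topological factor of an SFT, i.e. the image of an SFT under a continuous surjective map commuting with the shift maps. $\mathrm{Aut}(X)$ is the group, under composition, of homeomorphisms $X\to X$ commuting with $\sigma$; it is regarded as a discrete group, and amenability is in the sense of discrete groups. *)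

(* Defs.v *)
From HB Require Import structures.
From mathcomp Require Import all_boot all_order all_algebra.
From mathcomp Require Import all_classical all_reals.
From mathcomp Require Import topology function_spaces.

Set Implicit Arguments.
Unset Strict Implicit.
Unset Printing Implicit Defensive.

Import Order.TTheory GRing.Theory Num.Theory.

Local Open Scope classical_set_scope.
Local Open Scope ring_scope.

Definition full_shift (A : finType) : Type :=
  prod_topology (fun _ : int => discrete_topology A).

HB.instance Definition _ (A : finType) := Topological.on (full_shift A).

Definition sigma (A : finType) (x : full_shift A) : full_shift A :=
  fun n => x (n + 1).

Record shift_space (A : finType) := ShiftSpace {
  shift_points :> set (full_shift A);
  shift_closed : closed shift_points;
  shift_invariant : @sigma A @` shift_points = shift_points
}.

Definition occurs (A : finType) (w : seq A) (x : full_shift A) : Prop :=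
  exists i : int, w = [seq x (i + k%:Z) | k <- iota 0 (size w)].

Definition language (A : finType) (X : shift_space A) : set (seq A) :=
  [set w | exists2 x, shift_points X x & occurs w x].

Definition transitive_shift (A : finType) (X : shift_space A) : Prop :=
  forall u w : seq A, language X u -> language X w ->
    exists v : seq A, language X (u ++ v ++ w).

Definition finite_type (A : finType) (X : shift_space A) : Prop :=
  exists F : seq (seq A),
    X = [set x | forall w, w \in F -> ~ occurs w x] :> set (full_shift A).

Section ShiftMap.
Context (A : finType) (X : shift_space A).

Definition sigmaV (x : full_shift A) : full_shift A := fun n => x (n - 1).

Lemma sigmaK : cancel (@sigma A) sigmaV.
Proof. by move=> x; apply/funext => n; rewrite /sigma /sigmaV subrK. Qed.

Lemma sigmaVK : cancel sigmaV (@sigma A).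
Proof. by move=> x; apply/funext => n; rewrite /sigma /sigmaV addrK. Qed.

Lemma sigma_in (x : X) : sigma (val x) \in (X : set (full_shift A)).
Proof.
rewrite inE -[X in X _](shift_invariant X); exists (val x) => //.
exact: set_mem (valP x).
Qed.

Lemma sigmaV_in (x : X) : sigmaV (val x) \in (X : set (full_shift A)).
Proof.
rewrite inE; have := set_mem (valP x).
by rewrite -[X in X _ -> _](shift_invariant X) => -[y Xy <-]; rewrite sigmaK.
Qed.

Definition shift_map (x : X) : X := exist _ (sigma (val x)) (sigma_in x).

Definition shift_mapV (x : X) : X := exist _ (sigmaV (val x)) (sigmaV_in x).

Lemma shift_mapK : cancel shift_map shift_mapV.
Proof. by move=> x; apply: val_inj; rewrite /= sigmaK. Qed.

Lemma shift_mapVK : cancel shift_mapV shift_map.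
Proof. by move=> x; apply: val_inj; rewrite /= sigmaVK. Qed.

Lemma reindex_continuous (h : int -> int) :
  continuous (fun x : full_shift A => (fun n => x (h n)) : full_shift A).
Proof.
move=> x; apply/cvg_sup; first exact/fmap_filter/nbhs_filter.
move=> n.
apply: (@continuous_comp_initial _ (full_shift A) (discrete_topology A)
  (fun y : full_shift A => y n)).
exact: (@proj_continuous _ (fun=> discrete_topology A) (h n)).
Qed.

Lemma shift_map_continuous : continuous shift_map.
Proof.
apply: continuous_comp_initial => x.
apply: (@continuous_comp _ _ _ (fun y : X => val y) (@sigma A)).
  exact: initial_continuous.
exact: reindex_continuous.
Qed.

Lemma shift_mapV_continuous : continuous shift_mapV.
Proof.
apply: continuous_comp_initial => x.
apply: (@continuous_comp _ _ _ (fun y : X => val y) sigmaV).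
  exact: initial_continuous.
exact: reindex_continuous.
Qed.

End ShiftMap.

Definition sofic (A : finType) (X : shift_space A) : Prop :=
  exists (B : finType) (Y : shift_space B), finite_type Y /\
    exists f : Y -> X, [/\ continuous f, set_surj setT setT f &
      forall y : Y, f (shift_map y) = shift_map (f y)].

(* The inverse is a field, but it is determined by the map: see eq_Aut.       *)
Record Aut (A : finType) (X : shift_space A) := MkAut {
  aut_fun :> X -> X;
  aut_inv : X -> X;
  autK : cancel aut_fun aut_inv;
  autVK : cancel aut_inv aut_fun;
  aut_continuous : continuous aut_fun;
  autV_continuous : continuous aut_inv;
  aut_shift : forall x, aut_fun (shift_map x) = shift_map (aut_fun x)
}.

Section AutGroup.
Context (A : finType) (X : shift_space A).

Lemma eq_Aut (f g : Aut X) : aut_fun f = aut_fun g -> f = g.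
Proof.
case: f g => [f f' fK f'K fc f'c fs] [g g' gK g'K gc g'c gs] /= fg.
move: fK f'K fc f'c fs; rewrite {f}fg => fK f'K fc f'c fs.
have fg' : f' = g' by apply/funext => x; rewrite -[in LHS](g'K x) fK.
move: fK f'K f'c; rewrite {f'}fg' => fK f'K f'c.
by congr MkAut; exact: Prop_irrelevance.
Qed.

Definition aut_id : Aut X.
Proof. by exists id id => // x; exact: cvg_id. Defined.

Definition aut_comp (f g : Aut X) : Aut X.
Proof.
exists (f \o g) (aut_inv g \o aut_inv f).
- exact: can_comp (autK f) (autK g).
- exact: can_comp (autVK g) (autVK f).
- by move=> x; apply: continuous_comp; exact: aut_continuous.
- by move=> x; apply: continuous_comp; exact: autV_continuous.
- by move=> x /=; rewrite !aut_shift.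
Defined.

Definition aut_invg (f : Aut X) : Aut X.
Proof.
exists (aut_inv f) f.
- exact: autVK.
- exact: autK.
- exact: autV_continuous.
- exact: aut_continuous.
- by move=> x; apply: (can_inj (autK f)); rewrite aut_shift !autVK.
Defined.

HB.instance Definition _ := gen_eqMixin (Aut X).
HB.instance Definition _ := gen_choiceMixin (Aut X).

Lemma aut_compA : associative aut_comp.
Proof. by move=> f g h; exact: eq_Aut. Qed.

Lemma aut_comp1f : left_id aut_id aut_comp.
Proof. by move=> f; exact: eq_Aut. Qed.

Lemma aut_compf1 : right_id aut_id aut_comp.
Proof. by move=> f; exact: eq_Aut. Qed.

Lemma aut_compVf : left_inverse aut_id aut_invg aut_comp.
Proof. by move=> f; apply/eq_Aut/funext => x; exact: autK. Qed.

Lemma aut_compfV : right_inverse aut_id aut_invg aut_comp.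
Proof. by move=> f; apply/eq_Aut/funext => x; exact: autVK. Qed.

HB.instance Definition _ := isGroup.Build (Aut X)
  aut_compA aut_comp1f aut_compf1 aut_compVf aut_compfV.

Definition shift_aut : Aut X :=
  MkAut (@shift_mapK A X) (@shift_mapVK A X) (@shift_map_continuous A X)
    (@shift_mapV_continuous A X) (fun=> erefl).

End AutGroup.

Section Groups.
Context (G : groupType).

Definition subgroup (H : set G) : Prop := group_closed (mem H).

Definition normal_subgroup (H : set G) : Prop :=
  subgroup H /\ forall g h : G, H h -> H (h ^ g)%g.

Definition generated_subgroup (S : set G) : set G := smallest subgroup S.

(* Invariant mean on a subgroup H, as a left-invariant finitely additive      *)
(* probability measure on all subsets of H; mu is unconstrained elsewhere.    *)
Definition amenable (R : realType) (H : set G) : Prop :=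
  exists mu : set G -> R,
    [/\ mu H = 1,
        forall B, B `<=` H -> 0 <= mu B,
        forall B C, B `<=` H -> C `<=` H -> B `&` C = set0 ->
          mu (B `|` C) = mu B + mu C &
        forall h B, H h -> B `<=` H -> mu [set (h * x)%g | x in B] = mu B].

End Groups.

(* Main.v *)
(** Idea. By soficity [X] has a synchronizing word, and by transitivity a point
    [z] of least period [p] containing one, next to which points of [X] can be
    cut and glued freely. Consider the points that agree with [z] up to some
    place (the "break") and then leave it. For suitable words [J], the rule
    "next to a long run of [z], exchange a stretch of [z] with [J]" is an
    involution in [Aut X] that carries every such point outside the set [C] of
    points whose break starts with a given word [s] into [C]; two choices of
    [J], together with the identity, make the three images of the complement of
    [C] disjoint. If [h] in [N] fixes the orbit of [z] and is not a power of the
    shift, then [s] can be chosen so that [h] moves [C] off itself. Averaging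
    over [N] along the orbit of one point, each conjugate of [h] (it is in [N])
    shows that each image of [C] has at most half of the mean, so three disjoint
    sets have at least half of it each, which is absurd. Finally every [h] in
    [N] fixes the orbit of [z]: otherwise the commutator of [h] with one of the
    involutions would be in [N], fix [z] and not be a power of the shift. *)
Require Import Defs.
From HB Require Import structures.
From mathcomp Require Import all_boot all_order all_algebra.
From mathcomp Require Import all_classical all_reals.
From mathcomp Require Import topology function_spaces.
From mathcomp Require Import zify lra.

Set Implicit Arguments.
Unset Strict Implicit.
Unset Printing Implicit Defensive.

Import Order.TTheory GRing.Theory Num.Theory.
Import intdiv.

Local Open Scope classical_set_scope.
Local Open Scope ring_scope.

(** * Cylinders and block codes *)

Definition agree_on (A : finType) (a b : int) (x y : full_shift A) : Prop :=
  forall i, a <= i -> i < b -> x i = y i.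

Lemma agree_on_sym (A : finType) (a b : int) (x y : full_shift A) :
  agree_on a b x y -> agree_on a b y x.
Proof. by move=> xy i i1 i2; rewrite xy. Qed.

Definition splice (A : finType) (a : int) (x y : full_shift A) : full_shift A :=
  fun i => if i < a then x i else y i.

Definition shiftn (A : finType) (n : int) (x : full_shift A) : full_shift A :=
  fun i => x (i + n).

Definition point_of (A : finType) (X : shift_space A) (x : full_shift A)
  (Xx : shift_points X x) : X := exist _ x (mem_set Xx).

Lemma val_in (A : finType) (X : shift_space A) (x : X) : shift_points X (val x).
Proof. exact: set_mem (valP x). Qed.

(** Windows form a filter converging to [x] in each coordinate, hence in the product. Conversely, a
    window is a finite intersection of coordinate conditions, each open since the alphabet is
    discrete. *)
Lemma nbhs_agree (A : finType) (x : full_shift A) (U : set (full_shift A)) :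
  nbhs x U <-> exists R : nat, forall y, agree_on (- R%:Z) R%:Z y x -> U y.
Proof.
split=> [xU|[R yU]].
  pose F : set_system (full_shift A) :=
    [set U | exists R : nat, forall y, agree_on (- R%:Z) R%:Z y x -> U y].
  have FF : Filter F.
    split; first by exists 0%N.
      move=> V W [R RV] [R' RW]; exists (maxn R R') => y yx.
      by split; [apply: RV|apply: RW] => i iR1 iR2; apply: yx; lia.
    by move=> V W VW [R RV]; exists R => y yx; exact/VW/RV.
  suff: F --> x by apply.
  apply/cvg_sup => i V.
  rewrite (@nbhsE (initial_topology (fun f : full_shift A => f i))).
  move=> [_ [[W _ <-] Wx] WV]; exists (absz i).+1 => y yx; apply: WV => /=.
  suff -> : y i = x i by [].
  by apply: yx; lia.
have nbhs_n n : nbhs x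
    [set y | forall k, (k < n)%N -> y (k%:Z - R%:Z) = x (k%:Z - R%:Z)].
  elim: n => [|n IHn]; first by apply: filterS filterT.
  have xn : nbhs x [set y | y (n%:Z - R%:Z) = x (n%:Z - R%:Z)].
    exact: (@proj_continuous _ (fun=> discrete_topology A) (n%:Z - R%:Z) x
      _ (@discrete_set1 (discrete_topology A) _)).
  apply: filterS (filterI IHn xn) => y [yx yn] k.
  by rewrite ltnS leq_eqVlt => /predU1P[->|/yx].
apply: filterS (nbhs_n R.*2) => y yx; apply: yU => i iR1 iR2.
have -> : i = (absz (i + R%:Z))%:Z - R%:Z by lia.
by apply: yx; lia.
Qed.

(** Closedness of [X] enters through this form: points built by infinitely many gluings are put in
    [X] by finite approximation. *)
Lemma shift_agreeP (A : finType) (X : shift_space A) (y : full_shift A) :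
  (forall R : nat, exists2 x, shift_points X x & agree_on (- R%:Z) R%:Z x y) ->
  shift_points X y.
Proof.
move=> Xy; apply: shift_closed => U /nbhs_agree[R RU].
by have [x Xx xy] := Xy R; exists x; split=> //; exact: RU.
Qed.

Lemma shiftn0 (A : finType) (x : full_shift A) : shiftn 0 x = x.
Proof. by apply/funext => i; rewrite /shiftn addr0. Qed.

Lemma shiftnD (A : finType) (m n : int) (x : full_shift A) :
  shiftn m (shiftn n x) = shiftn (m + n) x.
Proof. by apply/funext => i; rewrite /shiftn addrA. Qed.

Lemma shiftn_in (A : finType) (X : shift_space A) (n : int) (x : full_shift A) :
  shift_points X x -> shift_points X (shiftn n x).
Proof.
have XS y : shift_points X y -> shift_points X (shiftn 1 y).
  by move=> Xy; rewrite -(shift_invariant X); exists y.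
have XV y : shift_points X y -> shift_points X (shiftn (- 1) y).
  by move=> Xy; have := sigmaV_in (point_of Xy); rewrite inE.
case: n => n Xx.
  elim: n => [|n /XS]; first by rewrite shiftn0.
  by rewrite shiftnD; have -> : 1 + n%:Z = n.+1 by lia.
elim: n => [|n /XV]; first exact: XV.
by rewrite shiftnD; have -> : -1 + Negz n = Negz n.+1 by lia.
Qed.

(** Tychonoff's theorem in terms of windows; asking for arbitrarily large [r] replaces the
    extraction of a subsequence. *)
Lemma full_shift_cluster (A : finType) (u : nat -> full_shift A) :
  exists y, forall R N : nat, exists2 r, (N <= r)%N & agree_on (- R%:Z) R%:Z (u r) y.
Proof.
have cpt : compact [set f : full_shift A | forall i, [set: A] (f i)].
  apply: (@tychonoff int (fun=> discrete_topology A) (fun=> setT)) => i.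
  apply: finite_compact; exact: (@finite_finset A setT).
have [|y [_ yu]] := cpt (u @ \oo) _; first by exists 0%N.
exists y => R N.
have /= := yu [set u r | r in [set r | (N <= r)%N]]
  [set x | agree_on (- R%:Z) R%:Z x y].
case=> [||x [[r Nr <-] xy]]; last by exists r.
  by exists N => // r Nr /=; exists r.
by apply/nbhs_agree; exists R.
Qed.


Lemma nbhs_shift_agree (A : finType) (X : shift_space A) (x : X) (U : set X) :
  nbhs x U <->
  exists R : nat, forall y : X, agree_on (- R%:Z) R%:Z (val y) (val x) -> U y.
Proof.
split=> [|[R RU]].
  rewrite (@nbhsE (initial_topology (fun y : X => val y))).
  move=> [_ [[V oV <-] Vx] VU].
  have /nbhs_agree[R RV] : nbhs (val x) V by apply: open_nbhs_nbhs; split.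
  by exists R => y yx; apply: VU; exact: RV.
have : nbhs (val x) [set y | agree_on (- R%:Z) R%:Z y (val x)].
  by apply/nbhs_agree; exists R.
have vc : continuous (fun y : X => val y) by exact: initial_continuous.
by move=> /(vc x); apply: (@filterS _ (nbhs x)) => y /RU.
Qed.

Definition shift_pt (A : finType) (X : shift_space A) (n : int) (x : X) : X :=
  point_of (shiftn_in n (val_in x)).

Lemma shift_pt0 (A : finType) (X : shift_space A) (x : X) : shift_pt 0 x = x.
Proof. by apply: val_inj; rewrite /= shiftn0. Qed.

Lemma shift_ptD (A : finType) (X : shift_space A) (m n : int) (x : X) :
  shift_pt m (shift_pt n x) = shift_pt (m + n) x.
Proof. by apply: val_inj; rewrite /= shiftnD. Qed.

Lemma shift_mapE (A : finType) (X : shift_space A) (x : X) :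
  shift_map x = shift_pt 1 x.
Proof. exact: val_inj. Qed.

Lemma shift_commute (A B : finType) (Y : shift_space B) (X : shift_space A)
    (f : Y -> X) (n : int) (y : Y) :
  (forall y, f (shift_map y) = shift_map (f y)) ->
  f (shift_pt n y) = shift_pt n (f y).
Proof.
move=> fs.
have fsn (m : nat) z : f (shift_pt m%:Z z) = shift_pt m%:Z (f z).
  elim: m => [|m IHm]; first by rewrite !shift_pt0.
  have -> : m.+1%:Z = 1 + m%:Z by lia.
  by rewrite -!shift_ptD -!shift_mapE fs IHm.
case: n => // n; have := fsn n.+1 (shift_pt (Negz n) y).
have e0 : n.+1%:Z + Negz n = 0 by lia.
rewrite shift_ptD e0 shift_pt0 => ->.
by rewrite shift_ptD addrC e0 shift_pt0.
Qed.

(* Curtis--Hedlund--Lyndon, by compactness of the domain. *)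
Lemma factor_radius (A B : finType) (Y : shift_space B) (X : shift_space A)
    (f : Y -> X) :
  continuous f -> (forall y, f (shift_map y) = shift_map (f y)) ->
  exists r : nat, forall (y y' : Y) (i : int),
    agree_on (i - r%:Z) (i + r%:Z) (val y) (val y') ->
    val (f y) i = val (f y') i.
Proof.
move=> fc fs; apply: contrapT => nor.
have {}nor (r : nat) : exists yy : Y * Y,
    agree_on (- r%:Z) r%:Z (val yy.1) (val yy.2) /\
    val (f yy.1) 0 <> val (f yy.2) 0.
  apply: contrapT => nyy; apply: nor; exists r => y y' i yy'.
  apply: contrapT => fyy'; apply: nyy; exists (shift_pt i y, shift_pt i y').
  rewrite !shift_commute //= /shiftn !add0r; split=> // j jr1 jr2.
  by apply: yy'; lia.
have [u uP] := choice nor.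
have [y yu] := full_shift_cluster (fun r => val (u r).1).
have Yy : shift_points Y y.
  apply: shift_agreeP => R; have [r _ ry] := yu R 0%N.
  by exists (val (u r).1) => //; exact: val_in.
pose y0 : Y := point_of Yy.
have [R yR] : exists R : nat, forall y' : Y,
    agree_on (- R%:Z) R%:Z (val y') y -> val (f y') 0 = val (f y0) 0.
  apply/(nbhs_shift_agree y0 [set y' | val (f y') 0 = val (f y0) 0]).
  apply: (fc y0 [set w | val w 0 = val (f y0) 0]).
  by apply/nbhs_shift_agree; exists 1%N => w; apply; lia.
(* With [r >= R], both components of the pair [u r] agree with the limit on the window given by
   continuity there. *)
have [r Rr ry] := yu R R.
have [ur] := uP r; case.
rewrite !yR // => i iR1 iR2.
by rewrite -ur ?ry //; lia.
Qed.

Lemma local_continuous (A : finType) (X : shift_space A) (f : X -> X) (r : nat) :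
  (forall (y y' : X) (i : int), agree_on (i - r%:Z) (i + r%:Z) (val y) (val y') ->
    val (f y) i = val (f y') i) -> continuous f.
Proof.
move=> fr; apply: continuous_comp_initial => x U /nbhs_agree[R RU].
apply/nbhs_shift_agree; exists (R + r)%N => y yx; apply: RU => i iR1 iR2.
by apply: fr => j jr1 jr2; apply: yx; lia.
Qed.

(** * Synchronizing words *)

(* The synchronizing word is the restriction of [s] to [-n, 0). *)
Definition synchronizes (A : finType) (X : shift_space A) (n : nat)
    (s : full_shift A) : Prop :=
  forall x y a, shift_points X x -> shift_points X y ->
    agree_on (a - n%:Z) a x (shiftn (- a) s) ->
    agree_on (a - n%:Z) a y (shiftn (- a) s) ->
    shift_points X (splice a x y).

(** With [M] bounding the lengths of the forbidden words, an occurrence starting before [-M] ends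
    before [0] and is read in [x]; any other lies where the glued point coincides with [y]. *)
Lemma finite_type_splice (B : finType) (Y : shift_space B) :
  finite_type Y -> exists M : nat, forall x y, shift_points Y x -> shift_points Y y ->
    agree_on (- M%:Z) M%:Z x y -> shift_points Y (splice 0 x y).
Proof.
move=> [F YF]; pose M := \max_(w <- F) size w; exists M => x y.
rewrite YF /= => Yx Yy xy w wF [i wi].
have wM : (size w <= M)%N.
  by rewrite /M (big_rem w) //= leq_maxl.
have [iM|Mi] := ltP i (- M%:Z).
  apply: (Yx w wF); exists i; rewrite [LHS]wi; apply/eq_in_map => k.
  rewrite mem_iota /= add0n => kw; rewrite /splice.
  by case: ifPn => //; lia.
apply: (Yy w wF); exists i; rewrite [LHS]wi; apply/eq_in_map => k.
rewrite mem_iota /= add0n => kw; rewrite /splice.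
by case: ifPn => // k0; apply: xy; lia.
Qed.

(* A word whose set of compatible central windows of preimages is minimal
   cannot have that set reduced by a longer past. *)
Lemma sofic_synchronizes (A : finType) (X : shift_space A) :
  sofic X -> shift_points X !=set0 ->
  exists s n, shift_points X s /\ synchronizes X n s.
Proof.
move=> [B [Y [/finite_type_splice[L YL] [f [fc fsurj fs]]]]] [x0 Xx0].
have [r fr] := factor_radius fc fs.
(* [L] letters on each side of the cut allow gluing in [Y]; the [r] letters needed to compute the
   image near the cut also lie inside the window. *)
pose M := (r + L)%N.
pose E (x : full_shift A) (n : nat) := [set b : {ffun 'I_M.*2 -> B} |
  `[< exists2 y : Y, agree_on (- n%:Z) 0 (val (f y)) x &
      forall k : 'I_M.*2, b k = val y (k%:Z - M%:Z) >]]%SET.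
have exE : exists m, `[< exists x n, shift_points X x /\ #|E x n| = m >].
  by exists #|E x0 0%N|; apply/asboolP; exists x0, 0%N.
case: (ex_minnP exE) => m /asboolP[s [n [Xs sm]]] mmin.
exists s, n; split=> // x y a Xx Xy xs ys.
pose x1 := shiftn a x; pose y1 := shiftn a y.
suff X1 : shift_points X (splice 0 x1 y1).
  suff -> : splice a x y = shiftn (- a) (splice 0 x1 y1) by exact: shiftn_in.
  apply/funext => i; rewrite /shiftn /splice /x1 /y1 /shiftn subrK.
  by have -> : (i - a < 0) = (i < a) by lia.
have x1s : agree_on (- n%:Z) 0 x1 s.
  move=> i i1 i2; rewrite /x1 /shiftn xs /shiftn ?addrK //; lia.
have y1s : agree_on (- n%:Z) 0 y1 s.
  move=> i i1 i2; rewrite /y1 /shiftn ys /shiftn ?addrK //; lia.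
have Xx1 : shift_points X x1 by exact: shiftn_in.
have Xy1 : shift_points X y1 by exact: shiftn_in.
apply: shift_agreeP => R; pose n' := maxn n R.
(* A longer past can only shrink the set, and minimality of [m] forbids that. So the central window
   of a preimage of [y1] is also that of a preimage following [x1] on the long past, and the two
   preimages can be glued. *)
have EE : E x1 n' = E s n.
  apply/eqP; rewrite eqEcard; apply/andP; split.
    apply/fintype.subsetP => b; rewrite inE => /asboolP[v vx1 vb].
    rewrite inE; apply/asboolP.
    exists v => // i i1 i2.
    by rewrite vx1 ?x1s //; lia.
  by rewrite sm mmin //; apply/asboolP; exists x1, n'.
have [eta _ etay] := fsurj (point_of Xy1) Logic.I.
have : [ffun k : 'I_M.*2 => val eta (k%:Z - M%:Z)] \in E s n.
  rewrite inE; apply/asboolP; exists eta; last by move=> k; rewrite ffunE.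
  by rewrite etay.
rewrite -EE inE => /asboolP[eta' eta'x eta'b].
have eta'eta : agree_on (- M%:Z) M%:Z (val eta') (val eta).
  move=> i i1 i2; have k2 : (absz (i + M%:Z)%R < M.*2)%N by lia.
  have := eta'b (Ordinal k2); rewrite ffunE /=.
  by have -> : (absz (i + M%:Z)%R)%:Z - M%:Z = i by lia.
have Ye : shift_points Y (splice 0 (val eta') (val eta)).
  apply: YL; [exact: val_in|exact: val_in|].
  by move=> i i1 i2; apply: eta'eta; rewrite /M; lia.
pose e : Y := point_of Ye.
exists (val (f e)); first exact: val_in.
move=> i i1 i2; rewrite /splice; case: ifPn => i0.
  rewrite -eta'x //; last by rewrite /n'; lia.
  apply: fr => j j1 j2; rewrite /= /splice; case: ifPn => // j0.
  by rewrite eta'eta //; rewrite /M; lia.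
have -> : y1 i = val (f eta) i by rewrite etay.
apply: fr => j j1 j2; rewrite /= /splice; case: ifPn => // j0.
by apply: eta'eta; rewrite /M; lia.
Qed.

Lemma transitive_agree (A : finType) (X : shift_space A) (x y : full_shift A)
    (R : nat) :
  transitive_shift X -> shift_points X x -> shift_points X y ->
  exists w (c : int), [/\ shift_points X w, R.*2%:Z < c,
    agree_on (- R%:Z) R%:Z w x &
    agree_on (c - R%:Z) (c + R%:Z) w (shiftn (- c) y)].
Proof.
move=> Xt Xx Xy.
pose u (x : full_shift A) := [seq x (- R%:Z + k%:Z) | k <- iota 0 R.*2.+1].
have nth_win (f : int -> A) d b n k : (k < n)%N ->
    nth d [seq f (b + k%:Z) | k <- iota 0 n] k = f (b + k%:Z).
  by move=> kn; rewrite (nth_map 0%N) ?size_iota // nth_iota.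
have Lu z : shift_points X z -> language X (u z).
  by move=> Xz; exists z => //; exists (- R%:Z); rewrite size_map size_iota.
have [v [w Xw [i uvi]]] := Xt _ _ (Lu _ Xx) (Lu _ Xy).
(* The words joined are those on [[-R, R]], of length [2R + 1], which gives the distance between
   their centers. *)
exists (shiftn (i + R%:Z) w), (R.*2.+1 + size v)%:Z; split.
- exact: shiftn_in.
- lia.
- move=> j j1 j2; pose k := absz (j + R%:Z)%R.
  have := congr1 (nth (x 0) ^~ k) uvi.
  rewrite nth_cat size_map size_iota.
  have -> : (k < R.*2.+1)%N by lia.
  rewrite !nth_win ?size_cat ?size_map ?size_iota; try lia.
  rewrite /shiftn => e; symmetry.
  have -> : j = - R%:Z + k%:Z by lia.
  by rewrite e; congr (w _); lia.
- move=> j j1 j2; pose k := absz (j + R%:Z)%R.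
  have := congr1 (nth (x 0) ^~ k) uvi.
  rewrite nth_cat size_map size_iota nth_cat.
  have -> : (k < R.*2.+1)%N = false by lia.
  have -> : (k - R.*2.+1 < size v)%N = false by lia.
  rewrite !nth_win; last first.
  - by rewrite -[@size (discrete_topology A) v]/(@size A v); lia.
  - rewrite !size_cat !size_map !size_iota.
    by rewrite -[@size (discrete_topology A) v]/(@size A v); lia.
  rewrite /shiftn => e; symmetry.
  have -> : j - (R.*2.+1 + size v)%N%:Z =
      - R%:Z + (k - R.*2.+1 - size v)%N%:Z.
    by rewrite -?[@size (discrete_topology A) v]/(@size A v); lia.
  by rewrite e; congr (w _); lia.
Qed.

(** * Breaks and loops at a synchronizing periodic point *)

(** Since [q] is a multiple of [p], inserting [q] letters of [z] between two words does not change
    the phase of [z]. *)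
Record anchor (A : finType) (X : shift_space A) (z : full_shift A) (p q : nat) :
    Prop := Anchor {
  anchor_in : shift_points X z;
  anchor_gt0 : (0 < p)%N;
  anchor_le : (p <= q)%N;
  anchor_dvd : (p%:Z %| q%:Z)%Z;
  anchor_per : forall i j, (p%:Z %| j)%Z -> z (i + j) = z i;
  anchor_min : forall j, (forall i, z (i + j) = z i) -> (p%:Z %| j)%Z;
  anchor_sync : synchronizes X q z
}.

Lemma least_period (A : finType) (z : full_shift A) (c : nat) :
  (0 < c)%N -> (forall i, z (i + c%:Z) = z i) ->
  exists p : nat, [/\ (0 < p)%N, forall i j, (p%:Z %| j)%Z -> z (i + j) = z i &
    forall j, (forall i, z (i + j) = z i) -> (p%:Z %| j)%Z].
Proof.
move=> c0 zc.
have exP : exists p, (0 < p)%N && `[< forall i, z (i + p%:Z) = z i >].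
  by exists c; rewrite c0; apply/asboolP.
case: (ex_minnP exP) => p /andP[p0 /asboolP zp] pmin; exists p.
have zpn (n : nat) i : z (i + n%:Z * p%:Z) = z i.
  elim: n i => [|n IHn] i; first by rewrite mul0r addr0.
  by rewrite intS mulrDl mul1r addrA IHn zp.
have zpm i j : (p%:Z %| j)%Z -> z (i + j) = z i.
  case/dvdzP => -[n ->|n ->]; first exact: zpn.
  rewrite -(zpn n.+1 (i + _)); congr (z _).
  by rewrite NegzE mulNr addrNK.
split=> // j zj; apply: contrapT => pj.
have jp : (j %% p%:Z)%Z != 0.
  by apply/eqP => jp0; apply: pj; apply/dvdz_mod0P.
have p0' : p%:Z != 0 by lia.
have j0 := modz_ge0 j p0'.
have jlt : (j %% p%:Z)%Z < p%:Z by rewrite ltz_pmod //; lia.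
have : (p <= absz (j %% p%:Z)%Z)%N; last by lia.
apply: pmin; apply/andP; split; first by lia.
apply/asboolP => i; rewrite gez0_abs // -[RHS]zj.
have -> : i + j = i + (j %% p%:Z)%Z + (j %/ p%:Z)%Z * p%:Z.
  by rewrite {1}(divz_eq j p%:Z); lia.
by rewrite [RHS]zpm // dvdz_mull.
Qed.

(** Transitivity leads from a synchronizing word back to itself after [c] steps, and synchronization
    allows repeating this return; the periodic point so obtained is a limit of points of [X]. *)
Lemma exists_anchor (A : finType) (X : shift_space A) :
  sofic X -> transitive_shift X -> shift_points X !=set0 ->
  exists z p q, anchor X z p q.
Proof.
move=> Xsof Xt X0; have [s [n [Xs ssync]]] := sofic_synchronizes Xsof X0.
have [w [c0 [Xw c0n ws1 ws2]]] := transitive_agree n Xt Xs Xs.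
have [c c0E] : exists c : nat, c0 = c%:Z by exists (absz c0); lia.
subst c0.
have c0 : (0 < c)%N by lia.
have cn0 : c%:Z != 0 by lia.
pose z : full_shift A := fun i => w (i %% c%:Z)%Z.
have zc (k : int) i : z (i + k * c%:Z) = z i.
  by rewrite /z addrC modzMDl.
have zw : agree_on (- n%:Z) c%:Z z w.
  move=> i i1 i2; rewrite /z; have [i0|i0] := ltP i 0.
    have -> : (i %% c%:Z)%Z = i + c%:Z.
      by rewrite -(modzDr i c%:Z) modz_small //; lia.
    rewrite ws2 /shiftn; [|lia|lia].
    by rewrite addrK ws1 //; lia.
  by rewrite modz_small //; lia.
have Xk (k : nat) : exists2 y, shift_points X y & agree_on (- n%:Z) (k%:Z * c%:Z) y z.
  elim: k => [|k [y Xy yz]].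
    exists w => // i i1 i2; symmetry; apply: zw => //; lia.
  have kc : 0 <= k%:Z * c%:Z by rewrite mulr_ge0.
  exists (splice (k%:Z * c%:Z) y (shiftn (- (k%:Z * c%:Z)) w)).
    apply: ssync => //; first exact: shiftn_in.
      move=> i i1 i2; rewrite yz //; last by lia.
      rewrite -(zc (- k%:Z)) mulNr /shiftn zw ?ws1 //; lia.
    by move=> i i1 i2; rewrite /shiftn ws1 //; lia.
  move=> i i1 i2; rewrite /splice; case: ifPn => ik; first by rewrite yz.
  rewrite /shiftn -zw; [by rewrite -mulNr zc|lia|].
  by move: i2; rewrite intS mulrDl mul1r; lia.
have Xz : shift_points X z.
  apply: shift_agreeP => R; have [y Xy yz] := Xk R.*2.
  exists (shiftn (R%:Z * c%:Z) y); first exact: shiftn_in.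
  have Rc : R%:Z <= R%:Z * c%:Z by rewrite ler_peMr //; lia.
  move=> i i1 i2; rewrite /shiftn yz ?zc //; first by lia.
  have -> : R.*2%:Z * c%:Z = R%:Z * c%:Z + R%:Z * c%:Z by rewrite -mulrDl; lia.
  lia.
have zc1 i : z (i + c%:Z) = z i by rewrite -[c%:Z]mul1r zc.
have [p [p0 zp zmin]] := least_period c0 zc1.
(* A positive multiple of [p] that is at least [n], so the window of [z] before [0] ends with the
   synchronizing word. *)
exists z, p, (n.+1 * p)%N; split=> //.
- by rewrite leq_pmull.
- by rewrite PoszM dvdz_mull.
have np : (n <= n.+1 * p)%N by rewrite mulSn; nia.
have zs i : - n%:Z <= i -> i < 0 -> z i = s i.
  by move=> i1 i2; rewrite zw ?ws1 //; lia.
move=> x y a Xx Xy xz yz; apply: ssync => // i i1 i2.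
  by rewrite xz /shiftn ?zs //; lia.
by rewrite yz /shiftn ?zs //; lia.
Qed.

Section Loops.
Context (A : finType) (X : shift_space A) (z : full_shift A) (p q : nat).
Hypothesis zA : anchor X z p q.

Let p_gt0 := anchor_gt0 zA.
Let le_pq := anchor_le zA.

Lemma dvdz_lt_le (j : int) : (p%:Z %| j)%Z -> 0 < j -> p%:Z <= j.
Proof.
case/dvdzP => k ->; have := p_gt0 => p0; rewrite pmulr_lgt0; last by lia.
by move=> k0; rewrite ler_peMl //; lia.
Qed.

(** A match over one period extends to all of [Z]. This is what gives two overlapping runs of [z]
    the same phase. *)
Lemma anchor_window (a b b' : int) :
  (forall i, a <= i -> i < a + p%:Z -> z (i + b) = z (i + b')) ->
  (p%:Z %| b - b')%Z.
Proof.
move=> zbb; apply: (anchor_min zA) => i.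
pose r := ((i - b' - a) %% p%:Z)%Z; pose k := ((i - b' - a) %/ p%:Z)%Z * p%:Z.
have kr : i - b' - a = k + r by exact: divz_eq.
have r0 : 0 <= r by rewrite modz_ge0 //; have := p_gt0; lia.
have rp : r < p%:Z by rewrite ltz_pmod //; have := p_gt0; lia.
have pk : (p%:Z %| k)%Z by rewrite dvdz_mull.
have -> : i + (b - b') = a + r + b + k by lia.
have -> : i = a + r + b' + k by lia.
by rewrite !(anchor_per zA _ pk) zbb //; lia.
Qed.

(* The break is recorded as the start of the first period block of [z] that is
   violated, hence somewhere in the [p] places before the first violation. *)
Definition break (t : int) (x : full_shift A) : Prop :=
  (forall i, i < t -> x i = z (i - t)) /\ ~ agree_on t (t + p%:Z) x (shiftn (- t) z).

(** The two left runs of [z] have the same phase, so distinct breaks are at least [p] apart, and the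
    violated block of the earlier one would lie inside the run of the later one. *)
Lemma break_unique (t t' : int) (x : full_shift A) :
  break t x -> break t' x -> t = t'.
Proof.
wlog tt' : t t' / t < t' => [hw|] xt xt'.
  have [tt'|t't|//] := ltgtP t t'; first exact: hw.
  by symmetry; exact: hw.
have [[xt1 xt2] [xt'1 _]] := (xt, xt'); exfalso; apply: xt2.
have ptt' : (p%:Z %| - t - - t')%Z.
  apply: (@anchor_window (t - p%:Z)) => i i1 i2.
  by rewrite -xt1 -?xt'1 //; lia.
have : p%:Z <= t' - t by apply: dvdz_lt_le; [move: ptt'; rewrite opprK addrC|lia].
move=> ptt i i1 i2; rewrite xt'1 /shiftn; last by lia.
by rewrite -[LHS](anchor_per zA _ ptt'); congr (z _); lia.
Qed.

Lemma break_exists (a : int) (x : full_shift A) :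
  (forall i, i < a -> x i = z (i - a)) -> x <> shiftn (- a) z ->
  exists t, break t x.
Proof.
move=> xa xz.
have p0 : 0 < p%:Z by have := p_gt0; lia.
have pn0 : p%:Z != 0 by lia.
have zk (k : nat) i : z (i - (a + k%:Z * p%:Z)) = z (i - a).
  by rewrite opprD addrA (anchor_per zA) // -mulNr dvdz_mull.
have exk : exists k : nat, `[< ~ agree_on (a + k%:Z * p%:Z)
    (a + k%:Z * p%:Z + p%:Z) x (shiftn (- (a + k%:Z * p%:Z)) z) >].
  apply: contrapT => nk; apply: xz; apply/funext => i.
  have [ia|ai] := ltP i a; first exact: xa.
  have k0 : 0 <= ((i - a) %/ p%:Z)%Z by rewrite divz_ge0 //; lia.
  apply: contrapT => xi; apply: nk; exists (absz ((i - a) %/ p%:Z)%Z).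
  rewrite gez0_abs //; apply/asboolP => xk; apply: xi.
  have := divz_eq (i - a) p%:Z; have := modz_ge0 (i - a) pn0.
  have : ((i - a) %% p%:Z)%Z < p%:Z by exact: ltz_pmod.
  move=> r1 r2 r3; rewrite xk /shiftn; [|lia|lia].
  by rewrite -{1}(gez0_abs k0) zk.
case: (ex_minnP exk) => k /asboolP xk kmin; exists (a + k%:Z * p%:Z); split=> // i ik.
rewrite zk; have [ia|ai] := ltP i a; first exact: xa.
have j0 : 0 <= ((i - a) %/ p%:Z)%Z by rewrite divz_ge0 //; lia.
have [j jE] : exists j : nat, ((i - a) %/ p%:Z)%Z = j%:Z.
  by exists (absz ((i - a) %/ p%:Z)%Z); lia.
have := divz_eq (i - a) p%:Z; have := modz_ge0 (i - a) pn0.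
have : ((i - a) %% p%:Z)%Z < p%:Z by exact: ltz_pmod.
rewrite jE => r1 r2 r3.
have jk : (j < k)%N by nia.
have xj : agree_on (a + j%:Z * p%:Z) (a + j%:Z * p%:Z + p%:Z) x
    (shiftn (- (a + j%:Z * p%:Z)) z).
  apply: contrapT => xj; have := kmin j; rewrite leqNgt jk => H.
  by have := H (introT (asboolP _) xj).
by rewrite xj /shiftn ?zk //; lia.
Qed.

Lemma break_shift (t n : int) (x : full_shift A) :
  break t x -> break (t - n) (shiftn n x).
Proof.
move=> [x1 x2]; split=> [i it|xn].
  by rewrite /shiftn x1; [congr (z _)|]; lia.
apply: x2 => i i1 i2; have := xn (i - n); rewrite /shiftn addrNK => ->; try lia.
by congr (z _); lia.
Qed.

Lemma break_agree (t : int) (x y : full_shift A) :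
  break t x -> (forall i, i < t + p%:Z -> x i = y i) -> break t y.
Proof.
move=> [x1 x2] xy; split=> [i it|yz].
  by rewrite -xy ?x1 //; lia.
by apply: x2 => i i1 i2; rewrite xy ?yz.
Qed.

(** The set [C] of the idea, the given word being [s] on [[0, l)]. *)
Definition cone (s : full_shift A) (l : nat) : set (full_shift A) :=
  [set x | exists2 t, break t x & agree_on t (t + l%:Z) x (shiftn (- t) s)].

(** An excursion from [z] and back; it returns in the original phase exactly when [p] divides
    [e]. *)
Record loop (J : full_shift A) (e : nat) : Prop := Loop {
  loop_in : shift_points X J;
  loop_left : forall i, i < 0 -> J i = z i;
  loop_right : forall i, e%:Z <= i -> J i = z (i - e%:Z)
}.

Lemma loop_anchor (e : nat) : (p%:Z %| e%:Z)%Z -> loop z e.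
Proof.
move=> pe; split=> // [|i ei]; first exact: anchor_in zA.
by rewrite (anchor_per zA) // rpredN.
Qed.

(** The [q] letters of [z] kept between the two loops are the synchronizing window at which they are
    glued. *)
Definition loop_cat (J : full_shift A) (e : nat) (J' : full_shift A) :=
  splice (e + q)%:Z J (shiftn (- (e + q)%:Z) J').

Lemma loop_catP (J J' : full_shift A) (e e' : nat) :
  loop J e -> loop J' e' -> loop (loop_cat J e J') (e + q + e').
Proof.
move=> Je Je'; have pq := anchor_dvd zA; split.
- apply: (anchor_sync zA); first exact: loop_in Je.
  + by apply: shiftn_in; exact: loop_in Je'.
  + move=> i i1 i2; rewrite (loop_right Je); last by lia.
    by rewrite /shiftn -[RHS](anchor_per zA _ pq); congr (z _); lia.
  + by move=> i i1 i2; rewrite /shiftn (loop_left Je') //; lia.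
- move=> i i0; rewrite /loop_cat /splice ifT; last by lia.
  exact: loop_left Je _ i0.
- move=> i ei; rewrite /loop_cat /splice ifF; last by lia.
  by rewrite /shiftn (loop_right Je'); [congr (z _)|]; lia.
Qed.

Lemma loop_cat_left (J J' : full_shift A) (e : nat) (i : int) :
  i < (e + q)%:Z -> loop_cat J e J' i = J i.
Proof. by move=> ie; rewrite /loop_cat /splice ie. Qed.

Lemma loop_cat_right (J J' : full_shift A) (e : nat) (i : int) :
  (e + q)%:Z <= i -> loop_cat J e J' i = J' (i - (e + q)%:Z).
Proof. by move=> ie; rewrite /loop_cat /splice ltNge ie. Qed.

Hypothesis Xt : transitive_shift X.

(** Transitivity only gives agreement on finite windows; gluing at the window of [z] before [0]
    restores the whole left half of [s]. *)
Lemma extend_right (s x : full_shift A) (R : nat) :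
  shift_points X s -> (forall i, i < 0 -> s i = z i) -> shift_points X x ->
  exists s' (c : int), [/\ shift_points X s', R.*2%:Z < c,
    forall i, i < R%:Z -> s' i = s i &
    agree_on (c - R%:Z) (c + R%:Z) s' (shiftn (- c) x)].
Proof.
move=> Xs sz Xx.
have [w [c [Xw Rc ws wx]]] := transitive_agree (R + q) Xt Xs Xx.
exists (splice 0 s w), c; split.
- apply: (anchor_sync zA) => // i i1 i2; rewrite ?ws /shiftn ?addr0 ?sz //; lia.
- by lia.
- by move=> i iR; rewrite /splice; case: ifPn => // i0; rewrite ws //; lia.
- by move=> i i1 i2; rewrite /splice ifF ?wx //; lia.
Qed.

(** An infinite [X] has a point [x] outside the finite orbit of [z]. A window of [x] long enough to
    differ from all [p] shifts of [z] is placed to the right of a left run of [z]. *)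
Lemma exists_break :
  infinite_set (X : set (full_shift A)) -> exists2 s, shift_points X s & break 0 s.
Proof.
move=> Xinf.
have [x Xx xz] : exists2 x, shift_points X x &
    forall k : nat, (k < p)%N -> x <> shiftn k%:Z z.
  apply: contrapT => nx; apply: Xinf.
  apply: (@sub_finite_set _ _ ((fun k : nat => shiftn k%:Z z) @` `I_p)); last first.
    by apply: finite_image; exact: finite_II.
  move=> x Xx; apply: contrapT => xk; apply: nx; exists x => // k kp xE.
  by apply: xk; exists k.
have {}xz (k : 'I_p) : exists i : int, x i <> z (i + k%:Z).
  by apply: contrapT => nk; apply: (xz k (ltn_ord k)); apply/funext => i;
    apply: contrapT => xi; apply: nk; exists i.
have [i_ xi_] := choice xz.
pose R := \max_k (absz (i_ k)).+1.
have [s [c [Xs Rc sz sx]]] := extend_right R (anchor_in zA) (fun _ _ => erefl) Xx.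
have sz0 i : i < 0 -> s i = z (i - 0) by move=> i0; rewrite subr0 sz //; lia.
have [|t st] := break_exists sz0; last first.
  by exists (shiftn t s); [exact: shiftn_in|rewrite -(subrr t); exact: break_shift].
rewrite oppr0 shiftn0 => szE.
have p0 : 0 < p%:Z by have := p_gt0; lia.
have pn0 : p%:Z != 0 by lia.
have r1 : 0 <= (c %% p%:Z)%Z by exact: modz_ge0.
have r2 : (c %% p%:Z)%Z < p%:Z by exact: ltz_pmod.
have r3 : (absz (c %% p%:Z)%Z < p)%N by lia.
(* The phase that [z] would have at the place [c] where [x] was put. *)
pose k := Ordinal r3; have kR : (absz (i_ k) < R)%N.
  by rewrite /R (bigD1 k) //= leq_max ltnSn.
apply: (xi_ k); have := sx (c + i_ k); rewrite /shiftn szE addrAC subrr add0r.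
move=> <-; [|lia|lia].
have -> : c + i_ k = i_ k + k%:Z + (c %/ p%:Z)%Z * p%:Z.
  by rewrite /= gez0_abs // {1}(divz_eq c p%:Z); lia.
by rewrite (anchor_per zA) // dvdz_mull.
Qed.

Lemma exists_loop (s : full_shift A) (l : nat) :
  shift_points X s -> break 0 s ->
  exists J (e : nat), [/\ loop J e, (p%:Z %| e%:Z)%Z, (l <= e)%N &
    agree_on 0 l%:Z J s].
Proof.
move=> Xs [sz _].
have sz0 i : i < 0 -> s i = z i by move=> i0; rewrite sz // subr0.
have [w [c0 [Xw Rc ws wz]]] := extend_right (l + q) Xs sz0 (anchor_in zA).
have [c c0E] : exists c : nat, c0 = c%:Z by exists (absz c0); lia.
subst c0.
pose J1 := splice c%:Z w (shiftn (- c%:Z) z).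
have J1c : loop J1 c.
  split.
  - apply: (anchor_sync zA) => //; first exact: shiftn_in (anchor_in zA).
    by move=> i i1 i2; rewrite wz //; lia.
  - move=> i i0; rewrite /J1 /splice ifT; last by lia.
    by rewrite ws ?sz0 //; lia.
  - by move=> i ci; rewrite /J1 /splice ifF //; lia.
(* Concatenating [p] copies gives length [p c + (p - 1) q], a multiple of [p], so the loop returns
   in phase. *)
have [J [Je JJ1]] : exists J, loop J (p.-1.+1 * c + p.-1 * q)%N /\
    agree_on 0 c%:Z J J1.
  elim: (p.-1) => [|k [J [Je JJ1]]].
    by exists J1; rewrite mul1n mul0n addn0.
  exists (loop_cat J1 c J); split.
    have -> : (k.+2 * c + k.+1 * q = c + q + (k.+1 * c + k * q))%N by lia.
    exact: loop_catP.
  by move=> i i1 i2; rewrite loop_cat_left //; lia.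
have pE : p.-1.+1 = p by rewrite prednK.
exists J, (p.-1.+1 * c + p.-1 * q)%N; split=> //.
- rewrite pE PoszD !PoszM rpredD //.
    by rewrite dvdz_mulr.
  by rewrite dvdz_mull //; exact: anchor_dvd zA.
- by rewrite pE; have := p_gt0; nia.
- move=> i i1 i2; rewrite JJ1; [|lia|lia].
  by rewrite /J1 /splice ifT ?ws //; lia.
Qed.

End Loops.

(** * Marker involutions *)

Section Marker.
Context (A : finType) (X : shift_space A) (z : full_shift A) (p q : nat).
Hypothesis zA : anchor X z p q.
Context (J : full_shift A) (e : nat) (s : full_shift A) (l K : nat).
Hypotheses (Je : loop X z J e) (pe : (p%:Z %| e%:Z)%Z) (ple : (p <= e)%N).
Hypotheses (Jbreak : break z p 0 J) (le_l : (l <= e)%N).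
Hypotheses (Js : agree_on 0 l%:Z J s) (K_large : (e.*2 + 3 * q <= K)%N).

Let p_gt0 := anchor_gt0 zA.
Let le_pq := anchor_le zA.
Let pq := anchor_dvd zA.

(** A site consists of a run of [K] letters of [z], the stretch [[b, b + e)] to be exchanged, and
    [q] letters of [z] for gluing on the right. *)
Definition empty_site (x : full_shift A) (b : int) : Prop :=
  agree_on (b - K%:Z) (b + (e + q)%:Z) x (shiftn (- b) z).

Definition full_site (x : full_shift A) (b : int) : Prop :=
  agree_on (b - K%:Z) (b + (e + q)%:Z) x (shiftn (- b) J).

(* A stretch of length [e] is followed by [q] letters of [z], which are enough to
   glue. The first negated clause puts a break right after it, so that sites
   cannot slide along a run of [z]; the second one prevents a second copy of [J]
   there from making two sites compete. *)
Definition active (x : full_shift A) (b : int) : Prop :=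
  [/\ empty_site x b \/ full_site x b,
      ~ agree_on (b + (e + q)%:Z) (b + (e + q)%:Z + p%:Z) x (shiftn (- b) z) &
      ~ agree_on (b + (e + q)%:Z) (b + (e + q)%:Z + l%:Z) x
          (shiftn (- (b + (e + q)%:Z)) s)].

Lemma site_left (x : full_shift A) (b : int) : active x b ->
  agree_on (b - K%:Z) b x (shiftn (- b) z).
Proof.
case=> -[xb|xb] _ _ i i1 i2; (rewrite xb; [|lia|lia]) => //.
by rewrite /shiftn (loop_left Je) //; lia.
Qed.

Lemma site_right (x : full_shift A) (b : int) : active x b ->
  agree_on (b + e%:Z) (b + (e + q)%:Z) x (shiftn (- b) z).
Proof.
case=> -[xb|xb] _ _ i i1 i2; (rewrite xb; [|lia|lia]) => //.
rewrite /shiftn (loop_right Je); last by lia.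
by rewrite -[LHS](anchor_per zA _ pe); congr (z _); lia.
Qed.

Lemma site_exclusive (x : full_shift A) (b : int) :
  empty_site x b -> full_site x b -> False.
Proof.
move=> xz xJ; case: Jbreak => _; apply=> i i1 i2; rewrite oppr0 shiftn0.
have := xz (i + b); rewrite xJ /shiftn ?addrK; [|lia|lia].
by apply; lia.
Qed.

(** If the sites were closer, the left run of [b'] would overlap a run of [z] at [b] and have the
    same phase; every relative position is then contradictory. Hence the swaps at distinct sites do
    not interact. *)
Lemma active_sep (x : full_shift A) (b b' : int) :
  active x b -> active x b' -> b < b' -> b + e%:Z + K%:Z < b'.
Proof.
move=> xb xb' bb'; rewrite ltNge; apply/negP => b'K.
have [xb1 xb2] := (site_left xb, site_right xb).
have xb'1 := site_left xb'.
have [st n1 n2] := xb; have [st' _ _] := xb'.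
pose t := b + (e + q)%:Z.
have le_pq' := le_pq.
(* If [b'] is inside the site of [b], equal phases leave a full block between [b] and [b'] and
   another between [b'] and [t]. This sets the break of [J] against a run of [z], or puts a block of
   [z] after [t]. *)
have [b't|tb'] := ltP b' t.
  have pbb' : (p%:Z %| - b' - - b)%Z.
    apply: (anchor_window zA (a := b - p%:Z)) => i i1 i2.
    have := xb1 i; rewrite xb'1 /shiftn; [|lia|lia].
    by apply; lia.
  have zbb' i : z (i - b') = z (i - b).
    by rewrite -[RHS](anchor_per zA _ pbb'); congr (z _); lia.
  have pb : p%:Z <= b' - b.
    apply: (dvdz_lt_le zA); last by lia.
    by rewrite -rpredN; move: pbb'; have -> : - (b' - b) = - b' - - b by lia.
  have pb' : p%:Z <= t - b'.
    apply: (dvdz_lt_le zA); last by lia.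
    have -> : t - b' = (- b' - - b) + (e%:Z + q%:Z) by rewrite /t; lia.
    by rewrite rpredD // rpredD.
  case: st => st.
    case: st' => st'.
      apply: n1 => i i1 i2; rewrite st' /shiftn ?zbb' //; lia.
    case: Jbreak => _; apply=> i i1 i2; rewrite oppr0 shiftn0.
    have := st' (i + b'); rewrite st /shiftn ?addrK; [|lia|lia].
    by rewrite -zbb' addrK => <- //; lia.
  case: Jbreak => _; apply=> i i1 i2; rewrite oppr0 shiftn0.
  have := st (i + b); rewrite xb'1 /shiftn ?addrK; [|lia|lia].
  by rewrite zbb' addrK => <- //; lia.
have pbb' : (p%:Z %| - b' - - b)%Z.
  apply: (anchor_window zA (a := t - p%:Z)) => i i1 i2.
  have := xb2 i; rewrite xb'1 /shiftn; [|lia|lia].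
  by apply; lia.
have zbb' i : z (i - b') = z (i - b).
  by rewrite -[RHS](anchor_per zA _ pbb'); congr (z _); lia.
(* From [t] on, either a block of [z] follows [t], or [b'] is [t] itself, where the two negated
   clauses of [active] exclude an empty and a full site. *)
have [tb'p|b'tp] := leP (t + p%:Z) b'.
  by apply: n1 => i i1 i2; rewrite xb'1 /shiftn ?zbb' //; lia.
have b'tE : b' = t.
  have [//|tb'1] := eqVneq b' t.
  have : p%:Z <= b' - t; last by lia.
  apply: (dvdz_lt_le zA); last by lia.
  have -> : b' - t = - ((- b' - - b) + (e%:Z + q%:Z)) by rewrite /t; lia.
  by rewrite rpredN rpredD // rpredD.
case: st' => st'.
  by apply: n1 => i i1 i2; rewrite st' /shiftn ?zbb' //; lia.
apply: n2 => i i1 i2; rewrite st' ?b'tE; [|lia|lia].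
by rewrite /shiftn Js //; lia.
Qed.

Lemma empty_site_agree (x y : full_shift A) (b : int) :
  agree_on (b - K%:Z) (b + e%:Z + K%:Z) x y -> empty_site x b -> empty_site y b.
Proof.
by move=> xy xb i i1 i2; rewrite -xy ?xb //; lia.
Qed.

Lemma active_agree (x y : full_shift A) (b : int) :
  agree_on (b - K%:Z) (b + e%:Z + K%:Z) x y -> active x b -> active y b.
Proof.
have le_pq' := le_pq.
move=> xy [xb n1 n2]; split.
- case: xb => xb; [left|right]; first exact: empty_site_agree xy xb.
  by move=> i i1 i2; rewrite -xy ?xb //; lia.
- by move=> yn; apply: n1 => i i1 i2; rewrite xy ?yn //; lia.
- by move=> yn; apply: n2 => i i1 i2; rewrite xy ?yn //; lia.
Qed.

(** * Swapping a single site *)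

Definition swap_site (b : int) (x : full_shift A) : full_shift A :=
  fun i => if (b <= i) && (i < b + e%:Z) then
    (if `[< empty_site x b >] then J (i - b) else z (i - b)) else x i.

Lemma swap_site_empty (b : int) (x : full_shift A) :
  empty_site x b -> full_site (swap_site b x) b.
Proof.
move=> xb i i1 i2; rewrite /swap_site asboolT //.
case: ifPn => // bi; rewrite xb // /shiftn.
have [ib|bi'] := ltP i b; first by rewrite (loop_left Je) //; lia.
rewrite (loop_right Je); last by lia.
by rewrite -[RHS](anchor_per zA _ pe); congr (z _); lia.
Qed.

Lemma swap_site_full (b : int) (x : full_shift A) :
  full_site x b -> empty_site (swap_site b x) b.
Proof.
move=> xb i i1 i2; rewrite /swap_site asboolF; last first.
  by move=> xe; exact: site_exclusive xe xb.
case: ifPn => // bi; rewrite xb // /shiftn.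
have [ib|bi'] := ltP i b; first by rewrite (loop_left Je) //; lia.
rewrite (loop_right Je); last by lia.
by rewrite -[LHS](anchor_per zA _ pe); congr (z _); lia.
Qed.

Lemma swap_site_out (b i : int) (x : full_shift A) :
  ~~ ((b <= i) && (i < b + e%:Z)) -> swap_site b x i = x i.
Proof. by rewrite /swap_site => /negbTE ->. Qed.

Lemma swap_site_active (b : int) (x : full_shift A) :
  active x b -> active (swap_site b x) b.
Proof.
move=> [xb n1 n2]; split.
- by case: xb => [/swap_site_empty|/swap_site_full]; [right|left].
- by move=> xn; apply: n1 => i i1 i2; rewrite -xn ?swap_site_out //; lia.
- by move=> xn; apply: n2 => i i1 i2; rewrite -xn ?swap_site_out //; lia.
Qed.

Lemma swap_site_agree (b : int) (x y : full_shift A) :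
  agree_on (b - K%:Z) (b + e%:Z + K%:Z) x y ->
  agree_on (b - K%:Z) (b + e%:Z + K%:Z) (swap_site b x) (swap_site b y).
Proof.
move=> xy i i1 i2; rewrite /swap_site.
have -> : `[< empty_site x b >] = `[< empty_site y b >].
  apply: asbool_equiv_eq; split; apply: empty_site_agree => //.
  exact: agree_on_sym.
by case: ifPn => // _; exact: xy.
Qed.

Lemma swap_siteK (b : int) (x : full_shift A) :
  active x b -> swap_site b (swap_site b x) = x.
Proof.
move=> xb; apply/funext => i.
have [bi|bi] := boolP ((b <= i) && (i < b + e%:Z)); last first.
  by rewrite !swap_site_out.
case: xb => -[xb|xb] _ _; rewrite {1}/swap_site bi.
  rewrite asboolF; last first.
    by move=> xe; exact: site_exclusive xe (swap_site_empty xb).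
  by rewrite xb //; lia.
rewrite asboolT; last exact: swap_site_full.
by rewrite xb //; lia.
Qed.

(** Gluing takes place at two copies of the synchronizing window: the [q] letters before [b] and the
    [q] letters before [b + e + q]. *)
Lemma swap_site_in (b : int) (x : full_shift A) :
  shift_points X x -> active x b -> shift_points X (swap_site b x).
Proof.
move=> Xx xb; have [J' [J'e xJ']] : exists J', loop X z J' e /\
    forall i, b <= i -> i < b + e%:Z -> swap_site b x i = J' (i - b).
  have [xe|xe] := boolP `[< empty_site x b >].
    by exists J; split=> // i i1 i2; rewrite /swap_site xe i1 i2.
  exists z; split; first exact: (loop_anchor zA pe).
  by move=> i i1 i2; rewrite /swap_site (negbTE xe) i1 i2.
have J'r i : b + e%:Z <= i -> J' (i - b) = z (i - b).
  move=> bi; rewrite (loop_right J'e); last by lia.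
  by rewrite -[LHS](anchor_per zA _ pe); congr (z _); lia.
pose t := b + (e + q)%:Z.
have -> : swap_site b x = splice t (splice b x (shiftn (- b) J')) x.
  apply/funext => i; rewrite /splice.
  have [it|ti] := ltP i t; last by rewrite swap_site_out //; lia.
  have [ib|bi] := ltP i b; first by rewrite swap_site_out //; lia.
  have [ie|ei] := ltP i (b + e%:Z); first by rewrite xJ'.
  rewrite swap_site_out; last by lia.
  by rewrite /shiftn J'r // (site_right xb) //; lia.
have zt i : z (i - t) = z (i - b).
  have pt : (p%:Z %| (e + q)%:Z)%Z by rewrite PoszD rpredD.
  by rewrite -[LHS](anchor_per zA _ pt); congr (z _); lia.
apply: (anchor_sync zA) => //.
- apply: (anchor_sync zA) => //; first by apply: shiftn_in; exact: loop_in J'e.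
    by move=> i i1 i2; rewrite (site_left xb) //; lia.
  by move=> i i1 i2; rewrite /shiftn (loop_left J'e) //; lia.
- move=> i i1 i2; rewrite /splice ifF; last by lia.
  by rewrite /shiftn J'r ?zt //; lia.
- by move=> i i1 i2; rewrite (site_right xb) /shiftn ?zt //; lia.
Qed.

(** * Swapping all active sites at once *)

Definition covers (x : full_shift A) (i b : int) : Prop :=
  active x b /\ (b <= i) && (i < b + e%:Z).

(** Restricting the swaps to sites in [B] serves an induction over finite ranges; [setT] gives the
    automorphism. The site chosen by [cid] is unique because active sites are far apart. *)
Definition marker (B : set int) (x : full_shift A) : full_shift A := fun i =>
  if pselect (exists b, B b /\ covers x i b) is left ex
  then swap_site (projT1 (cid ex)) x i else x i.

Lemma active_inj (x : full_shift A) (b b' i : int) :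
  active x b -> active x b' ->
  b - K%:Z <= i -> i < b + e%:Z + K%:Z -> b' <= i -> i < b' + e%:Z -> b = b'.
Proof.
move=> xb xb' i1 i2 i3 i4.
have [bb'|b'b|//] := ltgtP b b'.
  by have := active_sep xb xb' bb'; lia.
by have := active_sep xb' xb b'b; lia.
Qed.

Lemma marker_cover (B : set int) (x : full_shift A) (i b : int) :
  B b -> covers x i b -> marker B x i = swap_site b x i.
Proof.
move=> Bb xib; rewrite /marker; case: pselect => [ex|]; last first.
  by case; exists b.
case: cid => b' /= [Bb' xib']; congr swap_site.
have [xb /andP[i1 i2]] := xib; have [xb' /andP[i1' i2']] := xib'.
by apply: (active_inj (i := i) xb' xb); lia.
Qed.

Lemma marker_uncover (B : set int) (x : full_shift A) (i : int) :
  (forall b, B b -> ~ covers x i b) -> marker B x i = x i.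
Proof.
by move=> nb; rewrite /marker; case: pselect => // -[b [Bb xb]]; case: (nb b).
Qed.

Lemma marker_active_out (B : set int) (x : full_shift A) (b : int) :
  active x b -> ~ B b -> agree_on (b - K%:Z) (b + e%:Z + K%:Z) (marker B x) x.
Proof.
move=> xb nBb i i1 i2; apply: marker_uncover => b' Bb' [xb' /andP[i1' i2']].
by apply: nBb; rewrite (active_inj xb xb' i1 i2).
Qed.

Lemma marker_active_in (B : set int) (x : full_shift A) (b : int) :
  active x b -> B b ->
  agree_on (b - K%:Z) (b + e%:Z + K%:Z) (marker B x) (swap_site b x).
Proof.
move=> xb Bb i i1 i2.
have [bi|bi] := boolP ((b <= i) && (i < b + e%:Z)); first exact: marker_cover.
rewrite swap_site_out // marker_uncover // => b' Bb' [xb' /andP[i1' i2']].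
have bb' := active_inj xb xb' i1 i2 i1' i2'; subst b'.
by move: bi; rewrite i1' i2'.
Qed.

Lemma marker_add (B : set int) (x : full_shift A) (b : int) :
  active x b -> ~ B b ->
  marker (B `|` [set b]) x = swap_site b (marker B x).
Proof.
move=> xb nBb; apply/funext => i.
have [bi|bi] := boolP ((b <= i) && (i < b + e%:Z)).
  rewrite (marker_cover (b := b)) //; last by right.
  by apply: (swap_site_agree (agree_on_sym (marker_active_out xb nBb))); lia.
rewrite swap_site_out //.
have [[b' [Bb' xb']]|nb'] := pselect (exists b', B b' /\ covers x i b').
  by rewrite !(marker_cover (b := b')) //; left.
rewrite !marker_uncover // => b' Bb' xb'.
  by apply: nb'; exists b'.
case: Bb' => [Bb'|b'b]; first by apply: nb'; exists b'.
by case: xb' => _; rewrite b'b (negbTE bi).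
Qed.

(** One swap stays in [X]. Finite ranges follow by induction, since earlier swaps leave the next
    site active, and a limit gives all sites. *)
Lemma marker_in (x : full_shift A) :
  shift_points X x -> shift_points X (marker setT x).
Proof.
move=> Xx; have fin (a : int) (n : nat) :
    shift_points X (marker [set b | a <= b < a + n%:Z] x).
  elim: n => [|n IHn].
    suff -> : marker [set b | a <= b < a + 0%N%:Z] x = x by [].
    apply/funext => i; apply: marker_uncover => b /=; lia.
  have -> : [set b | a <= b < a + n.+1%:Z] =
      [set b | a <= b < a + n%:Z] `|` [set a + n%:Z].
    apply/seteqP; split=> b /=.
      have [->|bn] := eqVneq b (a + n%:Z); first by right.
      by move=> ab; left; lia.
    by case=> [|->]; lia.
  have [xb|xb] := pselect (active x (a + n%:Z)).
    have nBb : ~ [set b | a <= b < a + n%:Z] (a + n%:Z) by move=> /=; lia.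
    rewrite marker_add //; apply: swap_site_in => //.
    by apply: active_agree (xb); apply: agree_on_sym; exact: marker_active_out.
  suff -> : marker ([set b | a <= b < a + n%:Z] `|` [set a + n%:Z]) x =
    marker [set b | a <= b < a + n%:Z] x by [].
  apply/funext => i.
  have [[b' [Bb' xb']]|nb'] := pselect (exists b',
      [set b | a <= b < a + n%:Z] b' /\ covers x i b').
    by rewrite !(marker_cover (b := b')) //; left.
  rewrite !marker_uncover // => b' Bb' xb'.
    by apply: nb'; exists b'.
  case: Bb' => [Bb'|b'b]; first by apply: nb'; exists b'.
  by case: xb' => + _; rewrite b'b.
apply: shift_agreeP => R.
exists (marker [set b | - (R + e)%:Z <= b < - (R + e)%:Z + (R.*2 + e)%:Z] x) => //.
move=> i i1 i2; have [[b xib]|nb] := pselect (exists b, covers x i b).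
  have [_ bi] := xib.
  by rewrite !(marker_cover (b := b)) //=; lia.
by rewrite !marker_uncover // => b _ xb; apply: nb; exists b.
Qed.

Lemma marker_local (x y : full_shift A) (i : int) :
  agree_on (i - (e + K).+1%:Z) (i + (e + K).+1%:Z) x y ->
  marker setT x i = marker setT y i.
Proof.
have win b : (b <= i) && (i < b + e%:Z) ->
    forall x y : full_shift A,
    agree_on (i - (e + K).+1%:Z) (i + (e + K).+1%:Z) x y ->
    agree_on (b - K%:Z) (b + e%:Z + K%:Z) x y.
  by move=> bi x' y' xy j j1 j2; apply: xy; lia.
move=> xy; have [[b [xb bi]]|nb] := pselect (exists b, covers x i b).
  have xyb := win _ bi _ _ xy.
  rewrite !(marker_cover (b := b)) //; last by split=> //; exact: active_agree xyb xb.
  by apply: (swap_site_agree xyb); lia.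
rewrite !marker_uncover => [|b _ [yb bi]|b _ xb].
- by apply: xy; lia.
- apply: nb; exists b; split=> //; apply: active_agree yb.
  exact/agree_on_sym/win.
- by apply: nb; exists b.
Qed.

(** Old active sites stay active, so a new one would be far from all of them; nothing changed near
    it, and it was active before. *)
Lemma marker_activeE (x : full_shift A) (b : int) :
  active (marker setT x) b <-> active x b.
Proof.
have pres b' : active x b' -> active (marker setT x) b'.
  move=> xb; apply: active_agree (swap_site_active (xb)).
  by apply: agree_on_sym; exact: marker_active_in.
split=> [mb|]; last exact: pres.
apply: contrapT => xb; apply: (xb); apply: active_agree (mb) => i i1 i2.
apply: marker_uncover => b' _ [xb' /andP[i1' i2']]; apply: xb.
suff <- : b' = b by [].
by symmetry; exact: (active_inj mb (pres _ xb') i1 i2).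
Qed.

Lemma markerK (x : full_shift A) : marker setT (marker setT x) = x.
Proof.
apply/funext => i; have [[b [xb bi]]|nb] := pselect (exists b, covers x i b).
  rewrite (marker_cover (b := b)) //; last by split=> //; exact/marker_activeE.
  rewrite -[RHS](f_equal (@^~ i) (swap_siteK xb)).
  by apply: (swap_site_agree (marker_active_in xb Logic.I)); lia.
rewrite !marker_uncover // => b _ [xb bi]; apply: nb; exists b => //.
by split=> //; exact/marker_activeE.
Qed.

Lemma active_shift (n : int) (x : full_shift A) (b : int) :
  active (shiftn n x) b <-> active x (b + n).
Proof.
have sh (m : int) (y : full_shift A) c : active y (c + m) -> active (shiftn m y) c.
  have ag (a a' k : int) (w : full_shift A) :
      agree_on (a + m) (a' + m) y (shiftn (- (k + m)) w) ->
      agree_on a a' (shiftn m y) (shiftn (- k) w).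
    by move=> yw i i1 i2; rewrite /shiftn yw /shiftn; [congr (w _)|..]; lia.
  have ga (a a' k : int) (w : full_shift A) :
      agree_on a a' (shiftn m y) (shiftn (- k) w) ->
      agree_on (a + m) (a' + m) y (shiftn (- (k + m)) w).
    move=> yw i i1 i2; have := yw (i - m); rewrite /shiftn addrNK => ->; try lia.
    by congr (w _); lia.
  move=> [yb n1 n2]; split.
  - case: yb => yb; [left|right]; apply: ag.
      by move=> i i1 i2; apply: yb; lia.
    by move=> i i1 i2; apply: yb; lia.
  - move=> /ga yz; apply: n1 => i i1 i2; apply: yz; lia.
  - move=> /ga yz; apply: n2 => i i1 i2; rewrite yz; [|lia|lia].
    by congr (shiftn _ s _); lia.
split; last exact: sh.
have := sh (- n) (shiftn n x) (b + n).
by rewrite addrK shiftnD addNr shiftn0.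
Qed.

Lemma marker_shift (n : int) (x : full_shift A) :
  marker setT (shiftn n x) = shiftn n (marker setT x).
Proof.
apply/funext => i; rewrite [RHS]/shiftn.
have [[b [xb bi]]|nb] := pselect (exists b, covers x (i + n) b).
  have xb' : active (shiftn n x) (b - n) by apply/active_shift; rewrite subrK.
  rewrite (marker_cover (b := b - n)) //; last by split=> //; lia.
  rewrite (marker_cover (b := b)) //.
  rewrite /swap_site bi; have -> : (b - n <= i) && (i < b - n + e%:Z) by lia.
  have iE : i - (b - n) = i + n - b by lia.
  suff -> : `[< empty_site (shiftn n x) (b - n) >] = `[< empty_site x b >].
    by rewrite iE.
  apply: asbool_equiv_eq; split=> xe j j1 j2.
    have := xe (j - n); rewrite /shiftn subrK => ->; try lia.
    by congr (z _); lia.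
  by rewrite /shiftn xe; [congr (z _)|..]; lia.
rewrite !marker_uncover // => b _ [xb bi]; apply: nb.
  by exists b.
by exists (b + n); split; [exact/active_shift|lia].
Qed.

(** The letters before the break form an empty site, active because [s] does not follow. The swap
    writes [J] there, whose start becomes the break. No active site lies further left, as a violated
    block would have to follow it. *)
Lemma marker_break (x : full_shift A) (t : int) :
  break z p t x -> ~ agree_on t (t + l%:Z) x (shiftn (- t) s) ->
  break z p (t - (e + q)%:Z) (marker setT x) /\
  agree_on (t - (e + q)%:Z) (t - q%:Z) (marker setT x)
    (shiftn (- (t - (e + q)%:Z)) J).
Proof.
have le_pq' := le_pq.
move=> [xt nxt] nxs; pose b := t - (e + q)%:Z.
have tE : t = b + (e + q)%:Z by rewrite /b subrK.
have pt : (p%:Z %| (e + q)%:Z)%Z by rewrite PoszD rpredD.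
have zt i : z (i - b) = z (i - t).
  by rewrite -[RHS](anchor_per zA _ pt); congr (z _); lia.
have xe : empty_site x b by move=> i i1 i2; rewrite xt /shiftn ?zt //; lia.
have xb : active x b.
  split; first by left.
    by rewrite -tE => xz; apply: nxt => i i1 i2; rewrite xz /shiftn ?zt.
  by rewrite -tE.
have mJ i : b <= i -> i < b + e%:Z -> marker setT x i = J (i - b).
  move=> i1 i2; rewrite (marker_cover (b := b)) //; last by split=> //; lia.
  by rewrite /swap_site asboolT // i1 i2.
have mz i : i < b -> marker setT x i = z (i - b).
  move=> ib; rewrite marker_uncover ?xt ?zt //; first by lia.
  move=> b' _ [xb' i'b]; have b'b : b' < b by lia.
  have sep := active_sep xb' xb b'b; have xb'1 := site_left xb'.
  have pb : (p%:Z %| - b' - - t)%Z.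
    apply: (anchor_window zA (a := b' - p%:Z)) => j j1 j2.
    have := xb'1 j; rewrite xt /shiftn => [->//|]; lia.
  case: xb' => _ n1 _; apply: n1 => j j1 j2; rewrite xt /shiftn; last by lia.
  by rewrite -[LHS](anchor_per zA _ pb); congr (z _); lia.
split=> [|i i1 i2]; last by rewrite mJ /shiftn //; lia.
rewrite -/b; have bJ : break z p b (shiftn (- b) J).
  by have := break_shift zA (- b) Jbreak; rewrite opprK add0r.
apply: (break_agree zA bJ) => i ib; rewrite /shiftn; have [ib'|bi] := ltP i b.
  by rewrite mz // (loop_left Je) //; lia.
by rewrite mJ //; lia.
Qed.

(** Active sites need a long run of [z] and a violated block after it, so the last clause applies to
    points of period [p] and to points without long runs of [z]. *)
Lemma marker_aut : exists g : Aut X, [/\ forall x, g (g x) = x,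
  forall x t, break z p t (val x) ->
    ~ agree_on t (t + l%:Z) (val x) (shiftn (- t) s) ->
    break z p (t - (e + q)%:Z) (val (g x)) /\
    agree_on (t - (e + q)%:Z) (t - q%:Z) (val (g x))
      (shiftn (- (t - (e + q)%:Z)) J) &
  forall x, (forall b, agree_on (b - K%:Z) b (val x) (shiftn (- b) z) ->
    agree_on (b + (e + q)%:Z) (b + (e + q)%:Z + p%:Z) (val x) (shiftn (- b) z)) ->
    g x = x].
Proof.
pose g (x : X) : X := point_of (marker_in (val_in x)).
have gK x : g (g x) = x by apply: val_inj; exact: markerK.
have gc : continuous g.
  apply: (@local_continuous _ _ _ (e + K).+1) => x y i xy.
  exact: marker_local.
have gs x : g (shift_map x) = shift_map (g x).
  by apply: val_inj; exact: (marker_shift 1).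
exists (MkAut gK gK gc gc gs); split=> //= [x t|x xz].
  exact: marker_break.
apply: val_inj; apply/funext => i; apply: marker_uncover => b _ [xb _].
by have [_ + _] := xb; apply; apply: xz; exact: site_left.
Qed.

End Marker.

(** * Invariant means *)

Section Means.
Context (R : realType) (G : groupType) (H : set G).

Lemma subgroupP : subgroup H <->
  H 1%g /\ forall u v, H u -> H v -> H (u * v^-1)%g.
Proof.
split=> -[H1 Hdiv]; split.
- by move: H1; rewrite inE.
- by move=> u v Hu Hv; have := Hdiv u v; rewrite !inE; exact.
- by rewrite inE.
- by move=> u v; rewrite !inE; exact: Hdiv.
Qed.

Lemma subgroupV (u : G) : subgroup H -> H u -> H (u^-1)%g.
Proof. by case/subgroupP => H1 Hd Hu; rewrite -[(u^-1)%g]mul1g; exact: Hd. Qed.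

Lemma subgroupM (u v : G) : subgroup H -> H u -> H v -> H (u * v)%g.
Proof.
move=> Hs Hu Hv; rewrite -[v]invgK; case/subgroupP: (Hs) => _; apply=> //.
exact: subgroupV.
Qed.

Context (mu : set G -> R).
Hypotheses (mu1 : mu H = 1) (mu_ge0 : forall B, B `<=` H -> 0 <= mu B).
Hypothesis mu_add : forall B C, B `<=` H -> C `<=` H -> B `&` C = set0 ->
  mu (B `|` C) = mu B + mu C.
Hypothesis mu_inv : forall h B, H h -> B `<=` H ->
  mu [set (h * x)%g | x in B] = mu B.

Lemma mean_setD (B C : set G) : B `<=` C -> C `<=` H ->
  mu C = mu B + mu (C `\` B).
Proof.
move=> BC CH; rewrite -mu_add; first by rewrite setDUK.
- exact: subset_trans CH.
- by move=> x [/CH].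
- by apply/seteqP; split=> // x [Bx []].
Qed.

Lemma mean_le (B C : set G) : B `<=` C -> C `<=` H -> mu B <= mu C.
Proof.
move=> BC CH; rewrite (mean_setD BC CH) lerDl mu_ge0 // => x [Cx _].
exact: CH.
Qed.

Lemma mean_union_le (B C : set G) : B `<=` H -> C `<=` H ->
  mu (B `|` C) <= mu B + mu C.
Proof.
move=> BH CH; rewrite (@mean_setD B (B `|` C)); last 2 first.
- exact: subsetUl.
- by move=> x [/BH|/CH].
by rewrite lerD2l mean_le // => x [[]].
Qed.

(* Finitely many cosets of [H1] cover [H], and they all have the same mean. *)
Lemma mean_gt0 (T : finType) (c : G -> T) (H1 : set G) :
  subgroup H -> H1 `<=` H ->
  (forall n n', H n -> H n' -> c n = c n' -> H1 (n^-1 * n')%g) -> 0 < mu H1.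
Proof.
move=> Hs H1H cH1; rewrite lt_neqAle mu_ge0 // andbT eq_sym; apply/negP => /eqP mu0.
have mu_set0 : mu set0 = 0.
  have := @mu_add set0 set0 (@sub0set _ _) (@sub0set _ _) (setI0 _).
  by rewrite setU0 => /eqP; rewrite -subr_eq0 opprD addNKr oppr_eq0 => /eqP.
have fiber t : mu [set n | H n /\ c n = t] = 0.
  apply/eqP; rewrite eq_le mu_ge0 ?andbT => [|n [] //].
  have [[n0 [Hn0 cn0]]|nt] := pselect (exists n, H n /\ c n = t); last first.
    suff -> : [set n | H n /\ c n = t] = set0 by rewrite mu_set0.
    by apply/seteqP; split=> // n nt'; apply: nt; exists n.
  (* A nonempty fiber of [c] lies in the translate of [H1] by any of its elements. *)
  rewrite -mu0 -(mu_inv Hn0 H1H); apply: mean_le.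
    move=> n [Hn cn]; exists (n0^-1 * n)%g; last by rewrite mulVKg.
    by apply: cH1; rewrite ?cn0.
  by move=> _ [n H1n <-]; apply: subgroupM => //; exact: H1H.
have fibers (r : seq T) : mu [set n | H n /\ c n \in r] = 0.
  elim: r => [|t r IHr].
    suff -> : [set n | H n /\ c n \in [::]] = set0 by [].
    by apply/seteqP; split=> // n [].
  apply/eqP; rewrite eq_le mu_ge0 ?andbT => [|n [] //].
  have -> : [set n | H n /\ c n \in t :: r] =
      [set n | H n /\ c n = t] `|` [set n | H n /\ c n \in r].
    apply/seteqP; split=> n /=.
      by rewrite in_cons => -[Hn /predU1P[]]; [left|right].
    by rewrite in_cons; case=> -[Hn ->]; rewrite ?eqxx ?orbT.
  apply: le_trans (mean_union_le _ _) _; [by move=> n []|by move=> n []|].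
  by rewrite fiber IHr addr0.
have := fibers (enum T).
suff -> : [set n | H n /\ c n \in enum T] = H by rewrite mu1 => /eqP; rewrite oner_eq0.
by apply/seteqP; split=> [n []//|n Hn]; split=> //; rewrite mem_enum.
Qed.

(** Translation by [k i] sends [D i] into its complement in [H1], so this complement has at least
    half of the mean of [H1]. The three complements are pairwise disjoint, and [3/2] exceeds [1]. *)
Lemma no_paradox (H1 : set G) (D : 'I_3 -> set G) (k : 'I_3 -> G) :
  H1 `<=` H -> 0 < mu H1 -> (forall i, D i `<=` H1) -> (forall i, H (k i)) ->
  (forall i n, D i n -> H1 (k i * n)%g /\ ~ D i (k i * n)%g) ->
  (forall i j n, i != j -> H1 n -> D i n \/ D j n) -> False.
Proof.
move=> H1H mu0 DH1 Hk kD DD.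
pose E i := H1 `\` D i.
have EH1 i : E i `<=` H1 by move=> n [].
have DH i : D i `<=` H by move=> n /DH1/H1H.
have EH i : E i `<=` H by move=> n /EH1/H1H.
have muE i : mu H1 <= mu (E i) + mu (E i).
  have DE : mu H1 = mu (D i) + mu (E i) by exact: mean_setD.
  suff : mu (D i) <= mu (E i) by move=> DEi; rewrite DE lerD2r.
  rewrite -(mu_inv (Hk i) (DH i)); apply: mean_le => //.
  by move=> _ [n Dn <-]; have [H1kn nDkn] := kD _ _ Dn.
have disj i j : i != j -> E i `&` E j = set0.
  move=> ij; apply/seteqP; split=> // n [[H1n nDi] [_ nDj]].
  by case: (DD i j n ij H1n).
pose i0 : 'I_3 := ord0; pose i1 : 'I_3 := lift ord0 ord0; pose i2 : 'I_3 := ord_max.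
have le3 : mu (E i0) + mu (E i1) + mu (E i2) <= mu H1.
  rewrite -mu_add ?disj // -mu_add.
  - by apply: mean_le => // n [[]|]; exact: EH1.
  - by move=> n []; exact: EH.
  - exact: EH.
  - by rewrite setIUl !disj // setU0.
have := (muE i0, muE i1, muE i2); move=> [[]].
move: (mu H1) (mu (E i0)) (mu (E i1)) (mu (E i2)) mu0 le3 => a b c d.
lra.
Qed.

End Means.

(** * Normal amenable subgroups *)

Section Automorphisms.
Context (A : finType) (X : shift_space A) (z : full_shift A) (p q : nat).
Hypothesis zA : anchor X z p q.
Hypothesis Xt : transitive_shift X.
Hypothesis Xinf : infinite_set (X : set (full_shift A)).

Let p_gt0 := anchor_gt0 zA.

Definition anchor_pt : X := point_of (anchor_in zA).

Lemma aut_shift_pt (h : Aut X) (n : int) (x : X) :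
  h (shift_pt n x) = shift_pt n (h x).
Proof. exact/shift_commute/aut_shift. Qed.

Lemma aut_radius (h : Aut X) : exists r : nat, forall (x y : X) (i : int),
  agree_on (i - r%:Z) (i + r%:Z) (val x) (val y) -> val (h x) i = val (h y) i.
Proof. by apply: factor_radius; [exact: aut_continuous|exact: aut_shift]. Qed.

Lemma aut_inj (h : Aut X) : injective h.
Proof. exact: can_inj (autK h). Qed.

Definition fixes_orbit (h : Aut X) : Prop :=
  exists j : int, h anchor_pt = shift_pt j anchor_pt.

Lemma fixes_orbit_inv (h : Aut X) : fixes_orbit h -> fixes_orbit (aut_invg h).
Proof.
move=> [j hj]; exists (- j); apply: (aut_inj (h := h)).
by rewrite aut_shift_pt hj shift_ptD addNr shift_pt0 /= autVK.
Qed.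

(** The image is again [z] up to phase far to the left. Were it a full shift of [z], injectivity of
    [h] would make [x] one as well, leaving no break. *)
Lemma aut_break (h : Aut X) (x : X) (t : int) :
  fixes_orbit h -> break z p t (val x) -> exists t', break z p t' (val (h x)).
Proof.
move=> [j hj] [xt1 xt2]; have [r hr] := aut_radius h.
have p0 := p_gt0.
(* Moving left by a multiple of [p] keeps the phase and stays clear of the coding radius. *)
pose m := (r + absz j)%N%:Z * p%:Z.
have m1 : (r + absz j)%N%:Z <= m by rewrite ler_peMr //; lia.
have pm : (p%:Z %| - m)%Z by rewrite rpredN dvdz_mull.
pose a := t - j - m.
have hz i : val (h (shift_pt (- t) anchor_pt)) i = z (i - a).
  rewrite aut_shift_pt hj /= /shiftn -[RHS](anchor_per zA _ pm).
  by congr (z _); rewrite /a; lia.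
apply: (break_exists zA (a := a)) => [i ia|hx].
  rewrite -hz; apply: hr => k k1 k2; rewrite xt1 //; rewrite /a in ia; lia.
have : h x = h (shift_pt (- t) anchor_pt).
  by apply: val_inj; apply/funext => i; rewrite hz hx.
move=> /aut_inj xE; apply: xt2 => i _ _.
by rewrite xE.
Qed.

(** Left of [t - r] the image is a run of [z], so its violated block cannot lie there. The inverse
    will give the opposite bound. *)
Lemma aut_break_lower (h : Aut X) : fixes_orbit h ->
  exists M : nat, forall (x : X) (t t' : int), break z p t (val x) ->
    break z p t' (val (h x)) -> t - M%:Z < t'.
Proof.
move=> [j hj]; have [r hr] := aut_radius h.
exists (r + p)%N => x t t' [xt1 xt2] [ht1 ht2].
have hz i : i < t - r%:Z -> val (h x) i = z (i + (j - t)).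
  move=> it; have -> : z (i + (j - t)) = val (h (shift_pt (- t) anchor_pt)) i.
    by rewrite aut_shift_pt hj /= /shiftn; congr (z _); lia.
  by apply: hr => k k1 k2; rewrite xt1 //; lia.
rewrite ltNge; apply/negP => t't; apply: ht2 => i i1 i2.
have pj : (p%:Z %| j - t - (- t'))%Z.
  apply: (anchor_window zA (a := t' - p%:Z)) => k k1 k2.
  by rewrite -hz -?ht1 //; lia.
rewrite hz; last by lia.
rewrite /shiftn -[RHS](anchor_per zA _ pj); congr (z _); lia.
Qed.

Lemma aut_break_bound (h : Aut X) : fixes_orbit h ->
  exists M : nat, forall (x : X) (t t' : int), break z p t (val x) ->
    break z p t' (val (h x)) -> - M%:Z <= t - t' /\ t - t' < M%:Z.
Proof.
move=> ho; have [M1 hM1] := aut_break_lower ho.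
have [M2 hM2] := aut_break_lower (fixes_orbit_inv ho).
exists (M1 + M2)%N => x t t' xt ht.
have := hM1 _ _ _ xt ht; have := hM2 (h x) t' t ht; rewrite /= autK => /(_ xt); lia.
Qed.

(* An automorphism fixing the orbit of [z] moves breaks by a bounded amount, so
   it could agree with only finitely many powers of the shift on points with a
   break; a single point can be made to witness that it agrees with none. *)
Lemma aut_moves_cone (h : Aut X) : fixes_orbit h ->
  (forall j, exists x, h x <> shift_pt j x) ->
  exists s (l : nat), [/\ shift_points X s, break z p 0 s, (p <= l)%N &
    forall x : X, cone z p s l (val x) -> ~ cone z p s l (val (h x))].
Proof.
move=> ho hn; have [M hM] := aut_break_bound ho; have [r hr] := aut_radius h.
have [s [L [sb sL]]] : exists (s : X) (L : nat), break z p 0 (val s) /\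
    forall n : int, - M%:Z <= n -> n < - M%:Z + M.*2%:Z ->
    exists2 i : int, (absz i < L)%N & val (h s) i <> val s (i + n).
  (* The [2M] possible displacements are treated one by one. Each step copies a window of a point
     where [h] is not that power of the shift, too far to the right to disturb earlier witnesses. *)
  elim: (M.*2) => [|k [s [L [sb sL]]]].
    have [s Xs sb] := exists_break zA Xt Xinf.
    by exists (point_of Xs), 0%N; split=> // n; lia.
  have [x hx] := hn (- M%:Z + k%:Z).
  have [i0 hxi0] : exists i, val (h x) i <> val x (i + (- M%:Z + k%:Z)).
    apply: contrapT => ni; apply: hx; apply: val_inj; apply/funext => i.
    by apply: contrapT => hxi; apply: ni; exists i.
  pose R := (p + L + r + M.*2 + absz i0 + k)%N.+1.
  have sz i : i < 0 -> val s i = z i by move=> i0'; have [-> //] := sb; rewrite subr0.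
  have [s' [c [Xs' cR s's s'x]]] := extend_right zA Xt R (val_in s) sz (val_in x).
  exists (point_of Xs'), (L + (absz (c + i0)%R).+1)%N; split.
    by apply: (break_agree zA sb) => i ip; rewrite /= s's //; rewrite /R; lia.
  move=> n n1 n2; have [nk|nk] := eqVneq n (- M%:Z + k%:Z); last first.
    have [|i iL si] := sL n n1; first by lia.
    exists i; first by lia.
    rewrite /= s's; last by rewrite /R; lia.
    suff -> : val (h (point_of Xs')) i = val (h s) i by [].
    by apply: hr => j j1 j2; rewrite /= s's //; rewrite /R; lia.
  exists (c + i0); first by lia.
  rewrite /= s'x /shiftn; [|rewrite /R; lia|rewrite /R; lia].
  have -> : val (h (point_of Xs')) (c + i0) = val (h (shift_pt (- c) x)) (c + i0).
    by apply: hr => j j1 j2; rewrite /= s'x //; rewrite /R; lia.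
  rewrite aut_shift_pt /= /shiftn nk.
  have -> : c + i0 - c = i0 by lia.
  by have -> : c + i0 + (- M%:Z + k%:Z) - c = i0 + (- M%:Z + k%:Z) by lia.
(* Long enough to contain every witness after a displacement of at most [M] and a coding radius. If
   [x] and [h x] both had [s] at their breaks, [h s] and a shift of [s] would agree at a witness. *)
exists (val s), (L + M + r + p)%N; split=> //; [exact: val_in|by lia|].
move=> x [t xt xs] [t' ht hs].
have [t1 t2] := hM _ _ _ xt ht.
have [|i iL si] := sL (t - t') t1; first by lia.
apply: si.
have -> : val (h s) i = val (h x) (t + i).
  have -> : val (h s) i = val (h (shift_pt (- t) s)) (t + i).
    by rewrite aut_shift_pt /= /shiftn; congr (val (h s) _); lia.
  apply: hr => j j1 j2 /=; have [jt|tj] := ltP j t; last by rewrite xs //; lia.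
  have [xt1 _] := xt; have [sb1 _] := sb.
  by rewrite xt1 // /shiftn sb1 ?subr0 //; lia.
have [t't|tt'] := ltP (t + i) t'.
  have [ht1 _] := ht; have [sb1 _] := sb.
  by rewrite ht1 // sb1 ?subr0; [congr (z _)|]; lia.
by rewrite hs /shiftn; [congr (val s _)|..]; lia.
Qed.

Lemma aut_anchor_per (h : Aut X) (i j : int) :
  (p%:Z %| j)%Z -> val (h anchor_pt) (i + j) = val (h anchor_pt) i.
Proof.
move=> pj; have {2}-> : anchor_pt = shift_pt j anchor_pt.
  by apply: val_inj; apply/funext => k; rewrite /= /shiftn (anchor_per zA).
by rewrite aut_shift_pt.
Qed.

Lemma periodic_eq (a : int) (u v : full_shift A) :
  (forall i j, (p%:Z %| j)%Z -> u (i + j) = u i) ->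
  (forall i j, (p%:Z %| j)%Z -> v (i + j) = v i) ->
  agree_on a (a + p%:Z) u v -> u = v.
Proof.
move=> up vp uv; apply/funext => i.
have p0 : 0 < p%:Z by have := p_gt0; lia.
have pk : (p%:Z %| ((i - a) %/ p%:Z)%Z * p%:Z)%Z by rewrite dvdz_mull.
have r1 : 0 <= ((i - a) %% p%:Z)%Z by rewrite modz_ge0 //; lia.
have r2 : ((i - a) %% p%:Z)%Z < p%:Z by exact: ltz_pmod.
have -> : i = a + ((i - a) %% p%:Z)%Z + ((i - a) %/ p%:Z)%Z * p%:Z.
  by have := divz_eq (i - a) p%:Z; lia.
by rewrite up // vp // uv //; lia.
Qed.

Lemma loop_break (J s : full_shift A) (e l : nat) :
  loop X z J e -> (p <= l)%N -> break z p 0 s -> agree_on 0 l%:Z J s ->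
  break z p 0 J.
Proof.
move=> Je pl sb Js; apply: (break_agree zA sb) => i ip.
have [i0|i0] := ltP i 0; last by rewrite Js //; lia.
by have [sb1 _] := sb; rewrite sb1 // subr0 (loop_left Je).
Qed.

Definition trivial_aut (h : Aut X) : Prop := exists j, forall x, h x = shift_pt j x.

Section NormalAmenable.
Context (R : realType) (N : set (Aut X)).
Hypotheses (Nn : normal_subgroup N) (Na : amenable R N).

(** Elements of [N] fixing the orbit of [z] send [x0] to points with a break. They form a set [N1]
    of positive mean, and [no_paradox] is applied to the sets [D i] of those [n] for which [g i]
    sends [n x0] into the cone. *)
Lemma fixes_orbit_trivial (h : Aut X) : N h -> fixes_orbit h -> trivial_aut h.
Proof.
move=> Nh ho; apply: contrapT => hnt.
have hn j : exists x, h x <> shift_pt j x.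
  apply: contrapT => nx; apply: hnt; exists j => x; apply: contrapT => hx.
  by apply: nx; exists x.
have [s [l [Xs sb pl sC]]] := aut_moves_cone ho hn.
have [J0 [e0 [J0e pe0 le0 J0s]]] := exists_loop zA Xt l Xs sb.
have J0b : break z p 0 J0 by exact: loop_break J0e pl sb J0s.
have ze0 := loop_anchor zA pe0.
pose e := (e0 + q + e0)%N.
have pe : (p%:Z %| e%:Z)%Z by rewrite /e !PoszD !rpredD //; exact: anchor_dvd zA.
have ple : (p <= e)%N by rewrite /e; lia.
have lee : (l <= e)%N by rewrite /e; lia.
(* Both involutions exchange [z] with [J0] followed by [J'], where [J'] is [z] or [J0]. Both words
   begin with [s], and they differ after [e0 + q] letters. *)
have mk (J' : full_shift A) : loop X z J' e0 -> exists g : Aut X,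
    [/\ forall x, g (g x) = x, g anchor_pt = anchor_pt &
    forall x t, break z p t (val x) -> ~ cone z p s l (val x) ->
    exists2 b, break z p b (val (g x)) &
      agree_on b (b + e%:Z) (val (g x)) (shiftn (- b) (loop_cat q J0 e0 J'))].
  move=> J'e; have Je := loop_catP zA J0e J'e.
  have Js : agree_on 0 l%:Z (loop_cat q J0 e0 J') s.
    by move=> i i1 i2; rewrite loop_cat_left ?J0s //; lia.
  have Jb := loop_break Je pl sb Js.
  have [g [gK gb gz]] := marker_aut zA Je pe ple Jb lee Js (leqnn _).
  exists g; split=> //.
    apply: gz => b bz i i1 i2 /=; rewrite /shiftn.
    have pb : (p%:Z %| - b - 0)%Z.
      apply: (anchor_window zA (a := b - p%:Z)) => k k1 k2.
      by rewrite addr0; have := bz k; rewrite /= /shiftn => <- //; lia.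
    by rewrite -[LHS](anchor_per zA _ pb); congr (z _); lia.
  move=> x t xt xs; exists (t - (e + q)%:Z).
    apply: (proj1 (gb x t xt _)) => xts; apply: xs; exists t => //.
  move=> i i1 i2; apply: (proj2 (gb x t xt _)) => [xts||]; [|lia|lia].
  by apply: xs; exists t.
have [g1 [g1K g1z g1b]] := mk z ze0.
have [g2 [g2K g2z g2b]] := mk J0 J0e.
pose x0 : X := point_of Xs.
pose g (i : 'I_3) : Aut X := nth (aut_id X) [:: aut_id X; g1; g2] i.
have gK i x : g i (g i x) = x.
  by case: i => -[|[|[|//]]] i3; rewrite /g /=.
have gz i : g i anchor_pt = anchor_pt.
  by case: i => -[|[|[|//]]] i3; rewrite /g /=.
have gV i x : aut_inv (g i) x = g i x.
  by apply: (aut_inj (h := g i)); rewrite autVK gK.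
have gfix i n : fixes_orbit n -> exists j, g i (n anchor_pt) = shift_pt j anchor_pt.
  by move=> [j ->]; exists j; rewrite aut_shift_pt gz.
have [Ns Nc] := Nn; have [mu [mu1 mu_ge0 mu_add mu_inv]] := Na.
pose N1 := [set n | N n /\ fixes_orbit n].
have muN1 : 0 < mu N1.
  (* The first [p] letters determine the periodic point [n anchor_pt], so equal values make
     [n^-1 n'] fix [z]. *)
  apply: (@mean_gt0 _ _ _ mu mu1 mu_ge0 mu_add mu_inv _
    (fun n : Aut X => [ffun k : 'I_p => val (n anchor_pt) (nat_of_ord k)%:Z])) => //.
    by move=> n [].
  move=> n n' Hn Hn' nn'; split.
    by apply: subgroupM => //; exact: subgroupV.
  exists 0; rewrite shift_pt0 -[LHS]/(aut_inv n (n' anchor_pt)).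
  suff -> : n' anchor_pt = n anchor_pt by rewrite autK.
  apply: val_inj; apply: (@periodic_eq 0); try exact: aut_anchor_per.
  move=> i i1 i2; have k3 : (absz i < p)%N by lia.
  have /ffunP/(_ (Ordinal k3)) := nn'; rewrite !ffunE /=.
  by have -> : (absz i)%:Z = i by lia.
pose D i := [set n | N1 n /\ cone z p s l (val (g i (n x0)))].
apply: (@no_paradox _ _ _ mu mu_ge0 mu_add mu_inv N1 D
  (fun i => (h ^ (g i)^-1)%g)) => //.
- by move=> n [].
- by move=> i n [].
- by move=> i; exact: Nc.
- have kE i n x : ((h ^ (g i)^-1) * n)%g x = g i (h (g i (n x))).
    by rewrite -[LHS]/(aut_inv (aut_invg (g i)) (h (aut_inv (g i) (n x)))) gV.
  move=> i n [[Hn no] nC]; split.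
    split; first by apply: subgroupM => //; exact: Nc.
    have [j gnj] := gfix i n no; have [j' hj'] := ho.
    by exists (j + j'); rewrite kE gnj !aut_shift_pt hj' aut_shift_pt gz shift_ptD.
  by move=> [_]; rewrite kE gK; exact: sC.
- have gfixes i : fixes_orbit (g i) by exists 0; rewrite gz shift_pt0.
  have brk n i : N1 n -> exists t, break z p t (val (g i (n x0))).
    move=> [_ no]; have [t nt] := aut_break (x := x0) no sb.
    exact: aut_break (gfixes i) nt.
  have starts n b J' : break z p b (val (n x0)) ->
      agree_on b (b + e%:Z) (val (n x0)) (shiftn (- b) (loop_cat q J0 e0 J')) ->
      cone z p s l (val (n x0)).
    move=> nb nJ; exists b => // i i1 i2; rewrite nJ /shiftn; [|lia|lia].
    by rewrite loop_cat_left ?J0s //; lia.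
  (* As [g1] is an involution, [n x0] is the image of [g1 (n x0)]; when the latter is outside the
     cone, [n x0] starts at its break with the word of [g1]. *)
  have D1 n : N1 n -> ~ cone z p s l (val (g1 (n x0))) ->
      exists2 b, break z p b (val (n x0)) &
      agree_on b (b + e%:Z) (val (n x0)) (shiftn (- b) (loop_cat q J0 e0 z)).
    move=> Hn nC; have [t nt] := brk n (@Ordinal 3 1 isT) Hn.
    by have := g1b _ _ nt nC; rewrite g1K.
  have D2 n : N1 n -> ~ cone z p s l (val (g2 (n x0))) ->
      exists2 b, break z p b (val (n x0)) &
      agree_on b (b + e%:Z) (val (n x0)) (shiftn (- b) (loop_cat q J0 e0 J0)).
    move=> Hn nC; have [t nt] := brk n (@Ordinal 3 2 isT) Hn.
    by have := g2b _ _ nt nC; rewrite g2K.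
  have D01 n : N1 n -> cone z p s l (val (n x0)) \/ cone z p s l (val (g1 (n x0))).
    move=> Hn; apply: contrapT => /not_orP[n0 n1].
    by have [b nb nJ] := D1 n Hn n1; apply: n0; exact: starts nb nJ.
  have D02 n : N1 n -> cone z p s l (val (n x0)) \/ cone z p s l (val (g2 (n x0))).
    move=> Hn; apply: contrapT => /not_orP[n0 n1].
    by have [b nb nJ] := D2 n Hn n1; apply: n0; exact: starts nb nJ.
  have D12 n : N1 n -> cone z p s l (val (g1 (n x0))) \/ cone z p s l (val (g2 (n x0))).
    move=> Hn; apply: contrapT => /not_orP[n1 n2].
    have [b nb nJ] := D1 n Hn n1; have [b' nb' nJ'] := D2 n Hn n2.
    (* At the common break both words would be read, but past [e0 + q] letters one continues with
       [z] and the other with the break of [J0]. *)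
    have bb' := break_unique zA nb nb'; subst b'.
    case: J0b => _; apply=> i i1 i2; rewrite oppr0 shiftn0.
    have iE : b + (e0 + q)%:Z + i - b - (e0 + q)%:Z = i by lia.
    have := nJ (b + (e0 + q)%:Z + i); rewrite nJ'; [|lia|lia].
    rewrite /shiftn !loop_cat_right; [|lia|lia].
    by rewrite iE => -> //; lia.
  move=> i j n ij Hn; rewrite /D /=.
  case: i ij => -[|[|[|//]]] i3; case: j => -[|[|[|//]]] j3 // ij; rewrite /g /=.
  + by case: (D01 n Hn); [left|right].
  + by case: (D02 n Hn); [left|right].
  + by case: (D01 n Hn); [right|left].
  + by case: (D12 n Hn); [left|right].
  + by case: (D02 n Hn); [right|left].
  + by case: (D12 n Hn); [right|left].
Qed.

(* If [h] moves the orbit of [z], a marker automorphism [g] is conjugated by [h]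
   to one acting near another periodic orbit, so that [h] and [g] do not commute
   modulo the shift; but their commutator lies in [N] and fixes [z]. *)
Lemma normal_amenable_fixes_orbit (h : Aut X) : N h -> fixes_orbit h.
Proof.
move=> Nh; apply: contrapT => hno.
have [s Xs sb] := exists_break zA Xt Xinf.
have [J0 [e0 [J0e pe0 le0 J0s]]] := exists_loop zA Xt p Xs sb.
have J0b : break z p 0 J0 by exact: loop_break J0e (leqnn _) sb J0s.
(* Doubling [J0] gives a word that [J0] itself does not begin with, so [g] will act at the break of
   [x0]. *)
pose J := loop_cat q J0 e0 J0.
pose e := (e0 + q + e0)%N.
have Je : loop X z J e := loop_catP zA J0e J0e.
have pe : (p%:Z %| e%:Z)%Z by rewrite /e !PoszD !rpredD //; exact: anchor_dvd zA.
have ple : (p <= e)%N by rewrite /e; lia.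
have JJ0 : ~ agree_on 0 e%:Z J0 J.
  move=> J0J; case: J0b => _; apply=> i i1 i2; rewrite oppr0 shiftn0.
  have := J0J ((e0 + q)%:Z + i); rewrite /J loop_cat_right; last by lia.
  have -> : (e0 + q)%:Z + i - (e0 + q)%:Z = i by lia.
  move=> <-; [|lia|lia]; rewrite (loop_right J0e); last by lia.
  by rewrite -[RHS](anchor_per zA _ (anchor_dvd zA)); congr (z _); lia.
have Jb : break z p 0 J.
  apply: (loop_break Je (leqnn p) J0b) => i i1 i2.
  by rewrite /J loop_cat_left //; lia.
have [r hr] := aut_radius h.
(* The extra length ensures that a run of [K] letters, after losing [r] at each end to the coding by
   [h], still has a full period left of [0] or right of [e0]. *)
pose K := (e.*2 + 3 * q + (r.*2 + e0 + p.*2))%N.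
have [g [gK gb gz]] := marker_aut zA Je pe ple Jb (leqnn _) (fun _ _ _ => erefl)
  (leq_addr _ _ : _ <= K)%N.
have gper (h' : Aut X) : g (h' anchor_pt) = h' anchor_pt.
  apply: gz => b bz.
  suff -> : val (h' anchor_pt) = shiftn (- b) z by [].
  apply: (@periodic_eq (b - p%:Z)).
  - by move=> i j; exact: aut_anchor_per.
  - by move=> i j pj; rewrite /shiftn addrAC (anchor_per zA _ pj).
  - by move=> i i1 i2; rewrite bz //; rewrite /K; lia.
have gV x : aut_inv g x = g x.
  by apply: (aut_inj (h := g)); rewrite autVK gK.
have [Ns Nc] := Nn.
pose k := (h * (h^-1) ^ g)%g.
have Nk : N k by apply: subgroupM => //; apply: Nc; exact: subgroupV.
have kE x : k x = h (g (aut_inv h (g x))).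
  by rewrite -[LHS]/(h (aut_inv g (aut_inv h (g x)))) gV.
have [j kj] : trivial_aut k.
  apply: fixes_orbit_trivial => //; exists 0; rewrite shift_pt0 kE.
  have -> : g anchor_pt = anchor_pt := gper (aut_id X).
  by rewrite (gper (aut_invg h)) /= autVK.
pose x0 : X := point_of (loop_in J0e).
(* On a long run of [z] in this preimage [h] acts as on [anchor_pt], and part of the result lies
   where [x0] is [z] up to phase; so [h] would fix the orbit of [z]. *)
have gy : g (aut_inv h x0) = aut_inv h x0.
  apply: gz => b bz; exfalso; apply: hno.
  have hw i : b - K%:Z + r%:Z <= i -> i < b - r%:Z ->
      val (h anchor_pt) (i - b) = J0 i.
    move=> i1 i2; have -> : J0 i = val (h (aut_inv h x0)) i by rewrite autVK.
    have -> : val (h anchor_pt) (i - b) = val (h (shift_pt (- b) anchor_pt)) i.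
      by rewrite aut_shift_pt.
    by symmetry; apply: hr => m m1 m2; rewrite bz //; lia.
  suff [c cE] : exists c : int, exists a : int,
      forall i, a <= i -> i < a + p%:Z -> val (h anchor_pt) (i - b) = z (i - c).
    case: cE => a cE; exists (b - c); apply: val_inj.
    apply: (@periodic_eq (a - b)).
    - by move=> i m; exact: aut_anchor_per.
    - by move=> i m pm; rewrite /= /shiftn addrAC (anchor_per zA _ pm).
    - move=> i i1 i2; have := cE (i + b); rewrite addrK /= /shiftn => ->; try lia.
      by congr (z _); lia.
  have [bp|bp] := leP (b - K%:Z + r%:Z + p%:Z) 0.
    exists 0, (b - K%:Z + r%:Z) => i i1 i2; rewrite hw //; last by rewrite /K; lia.
    by rewrite subr0 (loop_left J0e) //; lia.
  exists e0%:Z, (b - r%:Z - p%:Z) => i i1 i2.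
  rewrite hw; [|rewrite /K; lia|lia].
  by rewrite (loop_right J0e) //; rewrite /K in bp; lia.
(* The commutator is the shift by [j] and [g] fixes the preimage of [x0], so [g] merely shifts [x0].
   But [g] also moves the break by [e + q] and writes [J] there, while a shift keeps [J0]. *)
have gx0 : g x0 = shift_pt j x0.
  apply: (can_inj (autVK h)); apply: (aut_inj (h := g)).
  have := kE x0; rewrite kj => kx0.
  have -> : g (aut_inv h (g x0)) = aut_inv h (shift_pt j x0) by rewrite kx0 autK.
  have hV y : aut_inv h (shift_pt j y) = shift_pt j (aut_inv h y).
    exact: (aut_shift_pt (aut_invg h)).
  by rewrite hV aut_shift_pt gy.
have x0b : break z p 0 (val x0) by [].
have [gb1 gb2] : break z p (0 - (e + q)%:Z) (val (g x0)) /\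
    agree_on (0 - (e + q)%:Z) (0 - q%:Z) (val (g x0)) (shiftn (- (0 - (e + q)%:Z)) J).
  by apply: gb => //; rewrite oppr0 shiftn0.
rewrite gx0 in gb1 gb2.
have jE := break_unique zA (break_shift zA j x0b) gb1.
apply: JJ0 => i i1 i2; have := gb2 (i - (e + q)%:Z).
rewrite /= /shiftn; have -> : i - (e + q)%:Z + j = i by lia.
have -> : i - (e + q)%:Z - (0 - (e + q)%:Z) = i by lia.
by apply; lia.
Qed.

End NormalAmenable.
End Automorphisms.

Lemma trivial_aut_generated (A : finType) (X : shift_space A) (h : Aut X) :
  trivial_aut h -> generated_subgroup [set shift_aut X] h.
Proof.
move=> [j hj] H [Hs /(_ _ erefl) Hsh].
have Hn (n : nat) : exists2 g : Aut X, H g & forall x, g x = shift_pt n%:Z x.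
  elim: n => [|n [g Hg gn]].
    exists 1%g; first by case/subgroupP: Hs.
    by move=> x; rewrite shift_pt0.
  exists (shift_aut X * g)%g; first exact: subgroupM.
  move=> x; rewrite -[LHS]/(shift_map (g x)) gn shift_mapE shift_ptD.
  by congr shift_pt; lia.
case: j hj => n hj; last have [g Hg gn] := Hn n.+1; first have [g Hg gn] := Hn n.
  by have -> : h = g by apply/eq_Aut/funext => x; rewrite hj gn.
have -> : h = (g^-1)%g; last exact: subgroupV.
apply/eq_Aut/funext => x; apply: (aut_inj (h := g)).
rewrite -[RHS]/(g (aut_inv g x)) autVK gn hj shift_ptD -[RHS]shift_pt0.
by congr shift_pt; lia.
Qed.

Theorem theorem1p1 (R : realType) (A : finType) (X : shift_space A) :
  sofic X -> transitive_shift X -> infinite_set (X : set (full_shift A)) ->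
  forall N : set (Aut X),
    normal_subgroup N -> amenable R N ->
    N `<=` generated_subgroup [set shift_aut X].
Proof.
move=> Xsof Xt Xinf N Nn Na h Nh; apply: trivial_aut_generated.
have X0 : shift_points X !=set0.
  apply: contrapT => X0; apply: Xinf.
  suff -> : (X : set (full_shift A)) = set0 by exact: finite_set0.
  by apply/seteqP; split=> // x Xx; apply: X0; exists x.
have [z [p [q zA]]] := exists_anchor Xsof Xt X0.
have ho := normal_amenable_fixes_orbit zA Xt Xinf Nn Na Nh.
exact: (fixes_orbit_trivial Xt Xinf Nn Na Nh ho).
Qed.
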